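(* Let $n\ge 2$ and let $0<d\le n$, $0\le\alpha<n$, $0\le\gamma\le\alpha$. Let $p=d/n$, let $q$ satisfy $d/n\le q\le n/\alpha$ (meaning $d/n\le q<\infty$ if $\alpha=0$), and put $$\delta=q(n-\alpha+\gamma).$$ Then there exists a finite constant $C>0$, independent of $f$ and $w$, such that for every weight $w$ on $\mathbb{R}^n$ and every locally integrable function $f$ on $\mathbb{R}^n$, $$\sup_{t>0}\,t\,H^{\delta}_{w}\bigl(\{x\in\mathbb{R}^n:\mathfrak{M}_{\alpha}f(x)>t\}\bigr)^{1/q}\le C\Bigl(\int_{\mathbb{R}^n}|f|^{p}\,(\mathfrak{M}_{\gamma q}w)^{p/q}\,dH^{d}\Bigr)^{1/p}.$$
   Context: A weight on $\mathbb{R}^n$ is a nonnegative locally integrable function. $\mathcal{D}$ is the family of all dyadic cubes $Q=2^{-k}(j+[0,1)^n)$, $k\in\mathbb{Z}$, $j\in\mathbb{Z}^n$; $l(Q)$ is the side length of $Q$, $|Q|$ its Lebesgue measure, and $\mathbf{1}_E$ the characteristic function of $E$. Dyadic fractional maximal operator of order $\beta\ge 0$: for locally integrable $f$, $$\mathfrak{M}_{\beta}f(x):=\sup_{Q\in\mathcal{D}}\mathbf{1}_Q(x)\,\Bigl(\frac{1}{|Q|}\int_Q|f|\,dy\Bigr)\,l(Q)^{\beta}\in[0,\infty].$$ Weighted Hausdorff content: for an exponent $s>0$, a weight $w$ and $E\subset\mathbb{R}^n$, $$H^{s}_{w}(E):=\inf\sum_{j=1}^{\infty}\Bigl(\frac{1}{|Q_j|}\int_{Q_j}w\,dx\Bigr)\,l(Q_j)^{s},$$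 the infimum being over all coverings of $E$ by countable families of dyadic cubes $Q_j$. The unweighted content is $H^{s}:=H^{s}_{1}$ (the case $w\equiv 1$), i.e. $H^s(E)=\inf\sum_j l(Q_j)^s$ over the same coverings. Choquet integral: for $g:\mathbb{R}^n\to[0,\infty]$, $$\int_{\mathbb{R}^n}g\,dH^{d}:=\int_0^{\infty}H^{d}(\{x\in\mathbb{R}^n:g(x)>t\})\,dt.$$ The convention $0\cdot\infty=0$ is used for products of functions. *)

(* Defs.v *)
From HB Require Import structures.
From mathcomp Require Import all_boot all_order all_algebra.
From mathcomp Require Import all_classical all_reals all_analysis.
Set Implicit Arguments.
Unset Strict Implicit.
Unset Printing Implicit Defensive.
Import Order.TTheory GRing.Theory Num.Theory.
Import numFieldNormedType.Exports.
Local Open Scope classical_set_scope.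
Local Open Scope ring_scope.
Local Open Scope ereal_scope.

(* Infimum of the total cost of countable (possibly finite) coverings of E by
   members of the family S; the members used are S (F k) for D k. *)
Section cover_cost.
Context {R : realType} {T I : Type}.
Variables (S : I -> set T) (c : I -> \bar R).

Definition cover_cost (E : set T) : \bar R :=
  ereal_inf [set r | exists (D : pred nat) (F : nat -> I),
    E `<=` \bigcup_(k in [set k | D k]) S (F k) /\
    r = \sum_(k <oo | D k) c (F k)].

Hypothesis c0 : forall i, 0 <= c i.

Lemma cover_cost_ge0 E : 0 <= cover_cost E.
Proof.
by apply: le_ereal_inf_tmp => _ [D [F [_ ->]]]; exact: nneseries_ge0.
Qed.

Lemma cover_cost_set0 : I -> cover_cost set0 = 0.
Proof.
move=> i0; apply/eqP; rewrite eq_le cover_cost_ge0 andbT.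
apply: ereal_inf_lbound; exists pred0, (fun=> i0); split => //.
by rewrite eseries_pred0.
Qed.

Lemma le_cover_cost : {homo cover_cost : A B / A `<=` B >-> A <= B}.
Proof.
move=> A B AB; apply/ereal_inf_le_tmp => _ [D [F [BF ->]]].
by exists D, F; split => //; exact: subset_trans AB BF.
Qed.

Lemma cover_cost_sigma_subadditive : sigma_subadditive cover_cost.
Proof.
move=> A; have [[i ioo]|] := pselect (exists i, cover_cost (A i) = +oo).
  rewrite (eseries_pinfty _ _ ioo) ?leey// => n _.
  by rewrite -ltNye (lt_le_trans _ (cover_cost_ge0 _)).
rewrite -forallNE => Aoo.
apply/lee_addgt0Pr => e e0.
rewrite (le_trans _ (epsilon_trick _ _ (ltW e0)))//; last first.
  by move=> n; exact: cover_cost_ge0.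
pose P n (G : pred nat * (nat -> I)) :=
  A n `<=` \bigcup_(k in [set k | G.1 k]) S (G.2 k) /\
  \sum_(k <oo | G.1 k) c (G.2 k) <= cover_cost (A n) + (e / (2 ^ n.+1)%:R)%:E.
have [G PG] : {G : nat -> pred nat * (nat -> I) & forall n, P n (G n)}.
  apply: (@choice _ _ P) => n.
  have en : (0 < e / (2 ^ n.+1)%:R)%R by rewrite divr_gt0 ?ltr0n ?expn_gt0.
  have Afin : cover_cost (A n) \is a fin_num.
    by rewrite ge0_fin_numE ?cover_cost_ge0// ltey; exact/eqP/Aoo.
  have [_ [D [F [AF ->]]] xS] := lb_ereal_inf_adherent en Afin.
  by exists (D, F); split => //; exact/ltW.
have /card_esym/ppcard_eqP[h] := card_nat2.
pose D k := (G (h k).1).1 (h k).2.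
pose F k := (G (h k).1).2 (h k).2.
apply: (@le_trans _ _ (\sum_(k <oo | D k) c (F k))).
  apply: ereal_inf_lbound; exists D, F; split => // x [n _ /((PG n).1)[m Dm Sx]].
  by exists (h^-1%FUN (n, m)); rewrite /D /F/= invK ?inE.
have -> : \sum_(k <oo | D k) c (F k) =
    \sum_(n <oo) \sum_(k <oo | (G n).1 k) c ((G n).2 k).
  rewrite nneseries_esumT; last by move=> n; exact: nneseries_ge0.
  under [RHS]eq_esum do rewrite nneseries_esum//.
  rewrite esum_esum// nneseries_esum//.
  rewrite -(esum_image [set k | D k] h (fun nk => c ((G nk.1).2 nk.2)));
    last by move=> a b _ _ /(congr1 h^-1%FUN); rewrite !funK ?inE.
  congr esum; apply/seteqP; split=> [_ [k Dk <-]//|nk [_ Gnk]].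
  by exists (h^-1%FUN nk); rewrite /D/= invK ?inE.
apply: lee_nneseries => [n _ _|n _]; last exact: (PG n).2.
exact: nneseries_ge0.
Qed.

End cover_cost.

Section lebesgue.
Context {R : realType} {n : nat}.

Definition box (ab : 'rV[R]_n * 'rV[R]_n) : set 'rV[R]_n :=
  [set x | forall i, (ab.1 ord0 i <= x ord0 i < ab.2 ord0 i)%R].

Definition box_volume (ab : 'rV[R]_n * 'rV[R]_n) : \bar R :=
  (\prod_(i < n) Num.max 0 (ab.2 ord0 i - ab.1 ord0 i))%:E.

Lemma box_volume_ge0 ab : 0 <= box_volume ab.
Proof. by rewrite lee_fin prodr_ge0// => i _; rewrite le_max lexx. Qed.

Definition lebesgue_outer : set 'rV[R]_n -> \bar R :=
  cover_cost box box_volume.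

Lemma lebesgue_outer_set0 : lebesgue_outer set0 = 0.
Proof. exact: (cover_cost_set0 box box_volume_ge0 (0, 0)%R). Qed.

HB.instance Definition _ := isOuterMeasure.Build R 'rV[R]_n lebesgue_outer
  lebesgue_outer_set0 (cover_cost_ge0 box box_volume_ge0)
  (@le_cover_cost _ _ _ box box_volume)
  (cover_cost_sigma_subadditive box box_volume_ge0).

End lebesgue.

(* R^n with the sigma-algebra of Lebesgue measurable sets. *)
Definition Rn (R : realType) (n : nat) : Type :=
  caratheodory_type (@lebesgue_outer R n).
HB.instance Definition _ (R : realType) (n : nat) := Measurable.on (Rn R n).

Definition lebesgue_rV {R : realType} {n : nat} : set (Rn R n) -> \bar R :=
  @lebesgue_outer R n.
HB.instance Definition _ (R : realType) (n : nat) :=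
  isMeasure.Build _ (Rn R n) R (@lebesgue_rV R n)
    (@caratheodory_measure0 _ _ (@lebesgue_outer R n))
    (@caratheodory_measure_ge0 _ _ (@lebesgue_outer R n))
    (@caratheodory_measure_sigma_additive _ _ (@lebesgue_outer R n)).

Section statement.
Context {R : realType} {n : nat}.
Implicit Types (f w : Rn R n -> R) (Q : int * 'rV[int]_n).
Local Notation mu := (@lebesgue_rV R n).

Definition locally_integrable_rV f : Prop :=
  measurable_fun [set: Rn R n] f /\
  forall K : set 'rV[R]_n, compact K -> \int[mu]_(x in K) `|f x|%:E < +oo.

Definition weight w : Prop :=
  (forall x, (0 <= w x)%R) /\ locally_integrable_rV w.

(* The pair (k, j) stands for the dyadic cube 2^(-k) (j + [0, 1)^n). *)
Definition dyadic_side Q : R := (2 ^ (- Q.1))%R.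

Definition dyadic_cube Q : set 'rV[R]_n :=
  [set x | forall i, (dyadic_side Q * (Q.2 ord0 i)%:~R <= x ord0 i <
                      dyadic_side Q * ((Q.2 ord0 i)%:~R + 1))%R].

Definition cube_avg f Q : \bar R :=
  (mu (dyadic_cube Q))^-1 * \int[mu]_(y in dyadic_cube Q) (f y)%:E.

Definition fractional_maximal (beta : R) f (x : Rn R n) : \bar R :=
  ereal_sup [set (\1_(dyadic_cube Q) x)%:E *
      cube_avg (fun y => `|f y|%R) Q * (dyadic_side Q `^ beta)%:E
    | Q in [set: int * 'rV[int]_n]].

Definition weighted_content (s : R) w : set (Rn R n) -> \bar R :=
  cover_cost dyadic_cube (fun Q => cube_avg w Q * (dyadic_side Q `^ s)%:E).

Definition choquet_integral (d : R) (g : Rn R n -> \bar R) : \bar R :=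
  \int[lebesgue_measure]_(t in `]0%R, +oo[)
    weighted_content d (fun=> 1%R) [set x | t%:E < g x].

End statement.

(* Main.v *)
(* Let F = |f|^p (M_(gamma q) w)^(p/q) and suppose its Choquet integral I is
   finite. Covering the level sets {F > 2^k} by cubes gives coefficients lam_P
   with F <= sum_P lam_P 1_P and sum_P lam_P l(P)^d <= 4 I + eps, which replaces
   the nonadditive Choquet integral by a discrete sum.

   Let e_P = sup_P (M_(gamma q) w)^(-p/q). Since d = n p and p <= 1, Jensen's
   inequality for sums of multiples of indicators bounds (int_Q |f|)^p, so that
   with b = p (n - alpha) every cube Q where the average of |f| times
   l(Q)^alpha exceeds t satisfies (if w is not null on Q; otherwise Q is a
   covering cube of cost 0)
     t^p l(Q)^b <= sum_(P in Q) lam_P l(P)^d e_P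
                   + l(Q)^d e_Q sum_(P contains Q) lam_P.
   Among the cubes where the second term dominates, a maximal family satisfying
   the packing condition sum_(R in Q) l(R)^d <= 2 l(Q)^d is selected. Adding the
   mass l(R)^d sum_(P contains R) lam_P at each selected cube R to the masses
   lam_P l(P)^d gives masses m_Q of total at most 3 (4 I + eps), and every Q as
   above lies in a cube G which is good:
     (t^p / 2) l(G)^b <= sum_(Q in G) m_Q e_Q.
   As e_Q <= e_G, the weighted cost of a good cube is at most
   (2 t^(-p) sum_(Q in G) m_Q)^(q/p). The maximal good cubes are disjoint and
   q/p >= 1, so their costs add up to at most (6 t^(-p) (4 I + eps))^(q/p). A
   cube with arbitrarily large good ancestors has content 0: in the sum over
   such an ancestor G finitely many Q are negligible against l(G)^b, so only a
   small tail of the m_Q bounds the cost of G. *)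
Require Import Defs.
From mathcomp Require Import all_boot all_order all_algebra.
From mathcomp Require Import all_classical all_reals all_analysis.
From mathcomp Require Import measurable_realfun ring lra.
Set Implicit Arguments.
Unset Strict Implicit.
Unset Printing Implicit Defensive.
Import Order.TTheory GRing.Theory Num.Theory.
Import numFieldNormedType.Exports.
Local Open Scope classical_set_scope.
Local Open Scope ring_scope.
Local Open Scope ereal_scope.

(** * Sums over countable index sets *)

Section esum_complements.
Context {R : realType}.
Implicit Types T : choiceType.

(** If [c] is [+oo], both sides are [+oo] when some term is positive and 0 otherwise; a finite
    positive [c] is divided out of the partial sums. *)
Lemma esumZl T (S : set T) (c : \bar R) (a : T -> \bar R) :
  0 <= c -> (forall i, S i -> 0 <= a i) ->
  \esum_(i in S) (c * a i) = c * \esum_(i in S) a i.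
Proof.
move=> c0 a0; apply/eqP; rewrite eq_le; apply/andP; split.
  apply: ge_ereal_sup => _ [X [finX XS] <-].
  rewrite fsbig_finite//= big_seq_cond -ge0_sume_distrr; last first.
    by move=> i /andP[+ _]; rewrite in_fset_set// inE => /XS/a0.
  rewrite -big_seq_cond -fsbig_finite//; apply: lee_wpmul2l => //.
  by apply: ereal_sup_ubound; exists X.
move: c0; case: c => [c| |]// c0; last first.
  have [[i [Si ai]]|H] := pselect (exists i, S i /\ 0 < a i).
    apply: (@le_trans _ _ (+oo * a i)); first by rewrite [leRHS]gt0_mulye// leey.
    apply: esum_ge; exists [set i]; last by rewrite fsbig_set1.
    by split=> // j ->.
  rewrite [X in _ * X]esum1 ?mule0.
    by apply: esum_ge0 => i Si; rewrite mule_ge0// a0.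
  move=> i Si; apply/eqP; rewrite eq_le a0// andbT leNgt; apply/negP => ai.
  by apply: H; exists i.
have [->|cn0] := eqVneq c 0%R.
  by rewrite mul0e; apply: esum_ge0 => i Si; rewrite mul0e.
have {cn0}c0 : (0 < c)%R by rewrite lt_def cn0.
rewrite -lee_pdivlMl//; apply: ge_ereal_sup => _ [X [finX XS] <-].
rewrite lee_pdivlMl//; apply: esum_ge; exists X => //.
rewrite !fsbig_finite//= [in leRHS]big_seq_cond -ge0_sume_distrr; last first.
  by move=> i /andP[+ _]; rewrite in_fset_set// inE => /XS/a0.
by rewrite -big_seq_cond.
Qed.

Lemma subset_le_esum T (A B : set T) (a : T -> \bar R) :
  A `<=` B -> (forall i, B i -> 0 <= a i) ->
  \esum_(i in A) a i <= \esum_(i in B) a i.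
Proof.
move=> AB a0; rewrite esum_mkcond [leRHS]esum_mkcond; apply: le_esum => i _.
case: ifPn => [/set_mem/AB Bi|_]; first by rewrite mem_set.
by case: ifPn => // /set_mem/a0.
Qed.

Lemma le_esum_term T (A : set T) (a : T -> \bar R) i :
  A i -> (forall i, A i -> 0 <= a i) -> a i <= \esum_(j in A) a j.
Proof.
move=> Ai a0; rewrite -[leLHS](@esum_set1 R T i a) ?a0//.
by apply: subset_le_esum => // j ->.
Qed.

Lemma exchange_esum (T1 T2 : choiceType) (A : set T1) (B : set T2)
    (a : T1 -> T2 -> \bar R) :
  (forall i j, A i -> B j -> 0 <= a i j) ->
  \esum_(i in A) \esum_(j in B) a i j = \esum_(j in B) \esum_(i in A) a i j.
Proof.
move=> a0; rewrite !esum_esum//; last by move=> j i Bj Ai; exact: a0.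
apply: (@reindex_esum _ _ _ _ _ (fun x => (x.2, x.1))); split.
- by move=> [j i] /= [].
- by move=> [j i] [j' i'] /= _ _ [-> ->].
- by move=> [i j] /= [Ai Bj]; exists (j, i).
Qed.

(** Going through the partial inverse of [pickle], extended by 0, makes the integration and
    measurability theorems for series available for sums over cubes. *)
Lemma esum_countType (T : countType) (a : T -> \bar R) :
  (forall i, 0 <= a i) ->
  \esum_(i in [set: T]) a i = \sum_(k <oo) oapp a 0 (@pickle_inv T k).
Proof.
move=> a0; rewrite nneseries_esumT; last by move=> k; case: pickle_inv.
transitivity (\esum_(k in range (@pickle T)) oapp a 0 (@pickle_inv T k)).
  rewrite esum_image; last by move=> i j _ _; exact: (pcan_inj (@pickleK T)).
  by apply: eq_esum => i _; rewrite pickleK_inv.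
rewrite [LHS]esum_mkcond; apply: eq_esum => k _; case: ifPn => // /negP kP.
case: pickle_inv (@pickle_invK T k) => //= i ik.
by case: kP; rewrite inE; exists i.
Qed.

(** Keep one preimage of each point of the image; the discarded terms are nonnegative. *)
Lemma esum_image_le (T1 T2 : choiceType) (D : set T1) (F : T1 -> T2)
    (g : T2 -> \bar R) : (forall i, 0 <= g i) ->
  \esum_(i in F @` D) g i <= \esum_(k in D) g (F k).
Proof.
move=> g0; have [[k0 _]|H] := pselect (exists k, D k); last first.
  have -> : F @` D = set0 by rewrite -subset0 => i [k Dk _]; apply: H; exists k.
  by rewrite esum_set0 esum_ge0.
have [s sP] : {s : T2 -> T1 & forall i, (F @` D) i -> D (s i) /\ F (s i) = i}.
  apply: (@choice _ _ (fun i k => (F @` D) i -> D k /\ F k = i)) => i.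
  have [[k Dk <-]|Fi] := pselect ((F @` D) i); first by exists k.
  by exists k0.
apply: (@le_trans _ _ (\esum_(k in s @` (F @` D)) g (F k))).
  rewrite [leRHS]esum_image; last first.
    move=> i j /[!inE] Fi Fj sij.
    by rewrite -(sP i Fi).2 sij (sP j Fj).2.
  by apply: le_esum => i Fi; rewrite (sP i Fi).2.
by apply: subset_le_esum => // _ [i Fi <-]; exact: (sP i Fi).1.
Qed.

Lemma esum_remainder (T : choiceType) (a : T -> \bar R) (eps : R) :
  (forall i, 0 <= a i) -> \esum_(i in [set: T]) a i < +oo -> (0 < eps)%R ->
  exists2 X : set T, finite_set X & \esum_(i in ~` X) a i <= eps%:E.
Proof.
move=> a0 afin eps0.
have sfin : \esum_(i in [set: T]) a i \is a fin_num.
  by rewrite ge0_fin_numE// esum_ge0.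
have [_ [X [finX _] <-] HX] := ub_ereal_sup_adherent eps0 sfin.
exists X => //.
have XE : \esum_(i in X) a i = \sum_(i \in X) a i by rewrite esum_fset.
have Xfin : \esum_(i in X) a i \is a fin_num.
  rewrite ge0_fin_numE ?esum_ge0//; apply: le_lt_trans afin.
  exact: subset_le_esum.
move: HX; rewrite -/(esum _ _) (esumID X) ?setTI// -XE.
by rewrite lteBlDr// lteD2lE// => /ltW.
Qed.

(** After exchanging the sums, each [j] contributes [a j] at most once, since it lies in at most one
    [J i]. *)
Lemma esum_disjoint_le (T1 T2 : choiceType) (A : set T1) (J : T1 -> set T2)
    (a : T2 -> \bar R) : (forall j, 0 <= a j) -> trivIset A J ->
  \esum_(i in A) \esum_(j in J i) a j <= \esum_(j in [set: T2]) a j.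
Proof.
move=> a0 tJ; under eq_esum do rewrite esum_mkcond.
rewrite exchange_esum//; last by move=> i j _ _; case: ifP.
apply: le_esum => j _.
have [[i0 [Ai0 Ji0]]|H] := pselect (exists i, A i /\ J i j); last first.
  rewrite esum1// => i Ai; case: ifPn => // /set_mem Jij.
  by exfalso; apply: H; exists i.
apply: (@le_trans _ _ (\esum_(i in [set i0]) a j)); last by rewrite esum_set1.
rewrite esum_mkcond [leRHS]esum_mkcond; apply: le_esum => i _.
case: ifPn => [/set_mem Ai|_]; last by case: ifP.
case: ifPn => [/set_mem Ji|_]; last by case: ifP.
rewrite ifT// inE/=; apply: tJ => //.
by exists j.
Qed.

Lemma lee_poweR2r (r : R) (x y : \bar R) :
  (0 <= r)%R -> 0 <= x -> x <= y -> x `^ r <= y `^ r.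
Proof.
move=> r0 x0 xy; apply: gt0_ler_poweR => //; rewrite in_itv/= leey andbT//.
exact: le_trans xy.
Qed.

(** With [S] the whole sum, each term satisfies a^r = a^(r-1) a <= S^(r-1) a, and these bounds add
    up to S^r. *)
Lemma esum_poweR_le T (A : set T) (a : T -> \bar R) (r : R) :
  (1 <= r)%R -> (forall i, A i -> 0 <= a i) ->
  \esum_(i in A) a i `^ r <= (\esum_(i in A) a i) `^ r.
Proof.
move=> r1 a0; have r0 : (0 < r)%R by exact: lt_le_trans r1.
set S := \esum_(i in A) a i; have S0 : 0 <= S by exact: esum_ge0.
have [->|Sy] := eqVneq S +oo; first by rewrite poweRyr ?gt_eqF// leey.
have powS x : 0 <= x -> x `^ r = x `^ (r - 1) * x.
  move=> x0; have [->|xn0] := eqVneq x 0; first by rewrite poweR0r ?gt_eqF// mule0.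
  have xD : poweRD_def x (r - 1) 1 by rewrite nneg_neq0_poweRD_def// subr_ge0.
  by rewrite -[in LHS](subrK 1%R r) [LHS]poweRD// poweRe1.
rewrite powS// -esumZl ?poweR_ge0//; apply: le_esum => i Ai.
rewrite powS ?a0//; apply: lee_wpmul2r; first exact: a0.
apply: lee_poweR2r; rewrite ?subr_ge0 ?a0//.
exact: le_esum_term.
Qed.

End esum_complements.

(** * Dyadic cubes and their volume *)

Section dyadic_cubes.
Context {R : realType} {n : nat}.
Implicit Types P Q G : int * 'rV[int]_n.
Local Notation cube := (@dyadic_cube R n).
Local Notation side := (@dyadic_side R n).

Lemma dyadic_side_gt0 Q : (0 < side Q)%R.
Proof. by rewrite exprz_gt0. Qed.

Lemma dyadic_side_ratio P Q : (Q.1 <= P.1)%R ->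
  exists m : nat, side Q = (side P * (2 ^+ m))%R.
Proof.
move=> QP; exists `|P.1 - Q.1|%N; rewrite /dyadic_side exprnP.
by rewrite -expfzDr// gez0_abs ?subr_ge0// addKr.
Qed.

Lemma le_dyadic_side P Q : (Q.1 <= P.1)%R -> (side P <= side Q)%R.
Proof.
move=> /dyadic_side_ratio[m ->]; rewrite ler_peMr ?(ltW (dyadic_side_gt0 _))//.
by rewrite exprn_ege1// ler1n.
Qed.

(** The side decreases with the first index, so [Q] is the larger cube. In units of [side P] the
    faces of both cubes have integer coordinates, so the strict inequalities given by a common point
    sharpen to the ones between faces that inclusion requires. *)
Lemma dyadic_cube_nested P Q : (Q.1 <= P.1)%R ->
  (exists x, cube P x /\ cube Q x) -> cube P `<=` cube Q.
Proof.
move=> QP [x [Px Qx]] y Py i; have /andP[Px1 Px2] := Px i.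
have /andP[Qx1 Qx2] := Qx i; have /andP[Py1 Py2] := Py i.
have [m sE] := dyadic_side_ratio QP; have sP := dyadic_side_gt0 P.
move: Qx1 Qx2; rewrite sE -!mulrA => Qx1 Qx2.
have mE : (2 ^+ m : R)%R = (2 ^+ m : int)%R%:~R by rewrite rmorphXn.
move: (le_lt_trans Qx1 Px2) (le_lt_trans Px1 Qx2).
rewrite !ltr_pM2l// mE -!intrD1 -!intrM !ltr_int !ltzD1 => jQP jPQ.
apply/andP; split.
- by apply: le_trans Py1; rewrite ler_pM2l// ler_int.
- by apply: (lt_le_trans Py2); rewrite ler_pM2l// -intrD1 ler_int lezD1.
Qed.

Lemma dyadic_cube_inj P Q : P.1 = Q.1 ->
  (exists x, cube P x /\ cube Q x) -> P = Q.
Proof.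
move=> PQ [x [Px Qx]]; case: P Q PQ Px Qx => [k j] [k' j'] /= <- Px Qx.
congr (_, _); apply/rowP => i; have s0 := dyadic_side_gt0 (k, j).
have /andP[Px1 Px2] := Px i; have /andP[Qx1 Qx2] := Qx i.
move: (le_lt_trans Qx1 Px2) (le_lt_trans Px1 Qx2).
rewrite /dyadic_side/= in s0 *.
rewrite !ltr_pM2l// -!intrD1 !ltr_int !ltzD1.
by move=> a b; apply/eqP; rewrite eq_le a b.
Qed.

Definition dyadic_corner Q : 'rV[R]_n := (\row_i (side Q * (Q.2 ord0 i)%:~R))%R.

Lemma dyadic_corner_mem Q : cube Q (dyadic_corner Q).
Proof.
by move=> i; rewrite mxE lexx/= ltr_pM2l ?dyadic_side_gt0// ltrDl ltr01.
Qed.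

(** If [Q] had the smaller side, nestedness would make [P] and [Q] the same set. But then this set
    contains the corner of [P] and its shift by [side Q], while two points of [Q] never differ by
    [side Q] in a coordinate. *)
Lemma dyadic_cube_sub_le P Q : (0 < n)%N -> cube P `<=` cube Q -> (Q.1 <= P.1)%R.
Proof.
move=> n0 PQ; rewrite leNgt; apply/negP => PQ1.
have QP1 : (P.1 <= Q.1)%R by exact: ltW.
have QP : cube Q `<=` cube P.
  apply: dyadic_cube_nested => //; exists (dyadic_corner P).
  by split; [exact/PQ/dyadic_corner_mem|exact: dyadic_corner_mem].
have sQ := dyadic_side_gt0 Q.
have [m sE] := dyadic_side_ratio QP1.
have m0 : (0 < m)%N.
  rewrite lt0n; apply/eqP => m0; move: sE; rewrite m0 expr0 mulr1 /dyadic_side.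
  have two1 : (2 != 1 :> R)%R by rewrite (eqr_nat _ 2 1).
  by move/(ieexprIz (ltr0Sn R 1) two1)/oppr_inj => PQE; rewrite PQE ltxx in PQ1.
pose y : 'rV[R]_n := (dyadic_corner P + const_mx (side Q))%R.
have Py : cube P y.
  move=> i; rewrite !mxE lerDl (ltW sQ)/= mulrDr mulr1 ltrD2l sE.
  by rewrite ltr_pMr// exprn_egt1// ?ltr1n// -lt0n.
have /andP[_ y2] := PQ _ Py (Ordinal n0).
have /andP[c1 _] := PQ _ (dyadic_corner_mem P) (Ordinal n0).
move: y2; rewrite !mxE mulrDr mulr1 ltrD2r => y2.
by move: c1; rewrite mxE leNgt y2.
Qed.

End dyadic_cubes.

(** * Measurability and volume of dyadic cubes *)

Section lebesgue_dyadic.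
Context {R : realType} {n : nat}.
Implicit Types P Q G : int * 'rV[int]_n.
Local Notation cube := (@dyadic_cube R n).
Local Notation side := (@dyadic_side R n).
Local Notation outer := (@lebesgue_outer R n).
Local Notation mu := (@lebesgue_rV R n).

Let splitV (a l u : R) : (Num.max 0 (Num.min u a - l) +
  Num.max 0 (u - Num.max l a) = Num.max 0 (u - l))%R.
Proof.
rewrite /Num.max /Num.min; do ! case: ifPn;
  rewrite ?subr_lt0 ?subr_gt0 -?leNgt => *; lra.
Qed.

(** Caratheodory's criterion: the hyperplane cuts each box of a covering into two boxes, [lo] and
    [hi], whose volumes add up to that of the box. *)
Lemma halfspace_measurable (i : 'I_n) (a : R) :
  measurable ([set x | x ord0 i < a]%R : set (Rn R n)).
Proof.
apply: le_caratheodory_measurable => X; set A := [set x | _].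
apply: le_ereal_inf_tmp => _ [D [F [XF ->]]].
pose lo k := ((F k).1, (\row_j if j == i then Num.min ((F k).2 ord0 j) a
                             else (F k).2 ord0 j)%R : 'rV[R]_n).
pose hi k := ((\row_j if j == i then Num.max ((F k).1 ord0 j) a
                             else (F k).1 ord0 j)%R : 'rV[R]_n, (F k).2).
have -> : \sum_(k <oo | D k) box_volume (F k) =
    \sum_(k <oo | D k) box_volume (lo k) + \sum_(k <oo | D k) box_volume (hi k).
  rewrite -nneseriesD; [|by move=> *; exact: box_volume_ge0..].
  apply: eq_eseriesr => k _; rewrite -EFinD; congr EFin.
  rewrite [LHS](bigD1 i)//= [X in (_ = X + _)%R](bigD1 i)//=.
  rewrite [X in (_ = _ + X)%R](bigD1 i)//= !mxE eqxx -(splitV a) mulrDl.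
  congr (_ * _ + _ * _)%R.
  - by apply: eq_bigr => j ji; rewrite !mxE (negPf ji).
  - by apply: eq_bigr => j ji; rewrite !mxE (negPf ji).
apply: leeD; apply: ereal_inf_lbound.
- exists D, lo; split=> // x [/XF[k Dk Fx] xa]; exists k => // j.
  have /andP[x1 x2] := Fx j; rewrite x1/= mxE; case: eqP => // ji.
  by rewrite lt_min x2 ji.
- exists D, hi; split=> // x [/XF[k Dk Fx] /negP]; rewrite -leNgt => xa.
  exists k => // j; have /andP[x1 x2] := Fx j; rewrite x2 andbT/= mxE.
  by case: eqP => // ji; rewrite ge_max x1 ji.
Qed.

Lemma measurable_dyadic_cube Q : measurable (cube Q : set (Rn R n)).
Proof.
pose A (i : 'I_n) : set (Rn R n) :=
  ~` [set x | x ord0 i < side Q * (Q.2 ord0 i)%:~R]%R `&`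
  [set x | x ord0 i < side Q * ((Q.2 ord0 i)%:~R + 1)]%R.
have -> : cube Q = \bigcap_(i in [set: 'I_n]) A i.
  apply/seteqP; split=> [x Qx i _|x Ax i].
  - by have /andP[x1 x2] := Qx i; split=> //=; apply/negP; rewrite -leNgt.
  - by have [/negP] := Ax i I; rewrite -leNgt => -> ->.
apply: fin_bigcap_measurable => // i _.
apply: measurableI; last exact: halfspace_measurable.
by apply: measurableC; exact: halfspace_measurable.
Qed.

Lemma lebesgue_outer_affine (s : R) (a : 'rV[R]_n) (E : set 'rV[R]_n) :
  (0 < s)%R ->
  outer [set (a + s *: x)%R | x in E] <= (s ^+ n)%:E * outer E.
Proof.
move=> s0; have sn0 : (0 < s ^+ n)%R by rewrite exprn_gt0.
rewrite -lee_pdivrMl//; apply: le_ereal_inf_tmp => _ [D [F [EF ->]]].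
rewrite lee_pdivrMl// -nneseriesZl; last by move=> *; exact: box_volume_ge0.
apply: ereal_inf_lbound.
exists D, (fun k => (a + s *: (F k).1, a + s *: (F k).2)%R); split.
  move=> _ [x /EF[k Dk Fx] <-]; exists k => // i /=.
  by rewrite !mxE lerD2l ltrD2l ler_pM2l// ltr_pM2l//; exact: Fx.
apply: eq_eseriesr => k _; rewrite -EFinM; congr EFin.
have -> : (s ^+ n = \prod_(i < n) s)%R by rewrite prodr_const card_ord.
rewrite -big_split/=; apply: eq_bigr => i _.
by rewrite !mxE maxr_pMr ?ltW// mulr0 opprD addrACA subrr add0r mulrBr.
Qed.

(** A cube is an affine image of the unit cube; the bound for affine images, applied to this map and
    to its inverse, gives the two inequalities. *)
Lemma lebesgue_dyadic_cube Q :
  mu (cube Q) = (side Q ^+ n)%:E * mu (cube (0, 0)%R).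
Proof.
have s0 := dyadic_side_gt0 (R := R) Q; have sn0 : (side Q != 0)%R by rewrite gt_eqF.
have side00 : side (0, 0)%R = 1%R by rewrite /dyadic_side oppr0 expr0z.
have QE : cube Q = [set (dyadic_corner Q + side Q *: x)%R | x in cube (0, 0)%R].
  apply/seteqP; split=> [x Qx|_ [x x0 <-] i].
  - exists ((side Q)^-1 *: (x - dyadic_corner Q))%R.
      move=> i; have := Qx i; rewrite !mxE side00 !mul1r add0r => /andP[x1 x2].
      rewrite mulr_ge0 ?invr_ge0 ?subr_ge0// ?(ltW s0)//=.
      by rewrite ltr_pdivrMl// mulr1 ltrBlDr addrC -{2}[side Q]mulr1 -mulrDr.
    by rewrite scalerA divff// scale1r addrC subrK.
  - have := x0 i; rewrite !mxE side00 !mul1r add0r => /andP[x1 x2].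
    by rewrite lerDl mulrDr ltrD2l ltr_pM2l// mulr_ge0// ltW.
apply/eqP; rewrite eq_le /lebesgue_rV; apply/andP; split.
  by rewrite {1}QE; exact: lebesgue_outer_affine.
rewrite -lee_pdivlMl ?exprn_gt0// -exprVn.
apply: le_trans
  (lebesgue_outer_affine (- (side Q)^-1 *: dyadic_corner Q)%R _ _);
  last by rewrite invr_gt0.
apply: le_outer_measure => x x0; exists (dyadic_corner Q + side Q *: x)%R.
  by rewrite QE; exists x.
by rewrite scalerDr scalerA mulVf// scale1r scaleNr addKr.
Qed.

Lemma lebesgue_outer_box_le ab : outer (box ab) <= box_volume ab.
Proof.
have <- : \sum_(k <oo | pred1 0%N k) box_volume ab = box_volume ab.
  rewrite nneseries_esum; last by move=> *; exact: box_volume_ge0.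
  rewrite (_ : [set x | pred1 0%N x] = [set 0%N]); last first.
    by apply/seteqP; split=> x /=; [move/eqP|move=> ->].
  by rewrite esum_set1// box_volume_ge0.
by apply: ereal_inf_lbound; exists (pred1 0%N), (fun=> ab); split=> // x; exists 0%N.
Qed.

Lemma lebesgue_dyadic_cube_lty Q : mu (cube Q) < +oo.
Proof.
have -> : cube Q = box (dyadic_corner Q, dyadic_corner Q + const_mx (side Q))%R.
  by apply/seteqP; split=> x Qx i; have := Qx i; rewrite /= !mxE mulrDr mulr1.
by apply: le_lt_trans (lebesgue_outer_box_le _) _; rewrite ltry.
Qed.

End lebesgue_dyadic.

(** * Jensen's inequality for sums of indicators *)

Section jensen.
Context {R : realType}.

(** The graph of x^r lies above its tangent at [s]; this is Young's inequality for the exponents r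
    and r/(r-1), applied to x and s^(r-1). *)
Lemma powR_tangent (r s x : R) : (1 <= r)%R -> (0 <= s)%R -> (0 <= x)%R ->
  (r * s `^ (r - 1) * x <= x `^ r + (r - 1) * s `^ r)%R.
Proof.
rewrite le_eqVlt => /predU1P[<-|r1] s0 x0.
  by rewrite subrr powRr0 mulr1 mul1r mul0r addr0 powRr1.
have r0 : (0 < r)%R by exact: lt_trans r1.
have r10 : (0 < r - 1)%R by rewrite subr_gt0.
have conj : (r^-1 + (r / (r - 1))^-1 = 1)%R by field; rewrite !gt_eqF.
have := conjugate_powR x0 (powR_ge0 s (r - 1)) r0 (divr_gt0 r0 r10) conj.
rewrite -powRrM mulrCA divff ?gt_eqF// mulr1 => H.
rewrite -mulrA -ler_pdivlMl// [(s `^ _ * x)%R]mulrC (le_trans H)//.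
by rewrite le_eqVlt; apply/orP; left; apply/eqP; field; rewrite !gt_eqF.
Qed.

Lemma ge0_integral_esum d (X : measurableType d) (mu : {measure set X -> \bar R})
    (T : countType) (D : set X) (f : T -> X -> \bar R) :
  measurable D -> (forall i, measurable_fun D (f i)) -> (forall i x, 0 <= f i x) ->
  \int[mu]_(x in D) (\esum_(i in [set: T]) f i x) =
  \esum_(i in [set: T]) \int[mu]_(x in D) f i x.
Proof.
move=> mD mf f0; rewrite esum_countType; last by move=> i; exact: integral_ge0.
under eq_integral do rewrite esum_countType//.
rewrite integral_nneseries//; last 2 first.
- by move=> k; case: pickle_inv => [i|] /=; [exact: mf|exact: measurable_cst].
- by move=> k x _; case: pickle_inv => [i|] /=.
by apply: eq_eseriesr => k _; case: pickle_inv => [i|] //=; rewrite integral0.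
Qed.

Lemma ge0_emeasurable_esum d (X : measurableType d) (T : countType) (D : set X)
    (f : T -> X -> \bar R) :
  (forall i, measurable_fun D (f i)) -> (forall i x, 0 <= f i x) ->
  measurable_fun D (fun x => \esum_(i in [set: T]) f i x).
Proof.
move=> mf f0; under eq_fun do rewrite esum_countType//.
apply: ge0_emeasurable_sum => [k x _ _|k _].
- by case: pickle_inv => [i|] /=.
- by case: pickle_inv => [i|] /=; [exact: mf|exact: measurable_cst].
Qed.

Let measurable_indic_EFin d (X : measurableType d) (D A : set X) :
  measurable A -> measurable_fun D (fun x => (\1_A x)%:E : \bar R).
Proof. by move=> mA; apply/measurable_EFinP/measurable_indic. Qed.

(** Jensen's inequality bounds [h] pointwise by the sum of the [b i] over the sets [A i] containing
    the point. As [b i * M i] equals S^(r-1) a_i M_i^(1/r), integration yields at most S^(r-1) S. *)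
Lemma integral_le_esum_powR d (X : measurableType d)
    (mu : {measure set X -> \bar R}) (T : countType) (D : set X) (A : T -> set X)
    (a : T -> \bar R) (M : T -> R) (h : X -> R) (r S : R) :
  (1 <= r)%R -> measurable D -> (forall i, measurable (A i)) ->
  (forall i, mu (A i) <= (M i)%:E) -> (forall i, 0 < M i)%R ->
  (forall i, 0 <= a i) -> (0 < S)%R ->
  measurable_fun D h -> (forall x, 0 <= h x)%R ->
  (forall x, D x -> (h x `^ r^-1)%:E <= \esum_(i in [set i | A i x]) a i) ->
  \esum_(i in [set: T]) (a i * (M i `^ r^-1)%:E) <= S%:E ->
  \int[mu]_(x in D) (h x)%:E <= (S `^ r)%:E.
Proof.
move=> r1 mD mA muA M0 a0 S0 mh h0 ha aS.
have r0 : (0 < r)%R by exact: lt_le_trans r1.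
have aM0 i : 0 <= a i * (M i `^ r^-1)%:E by rewrite mule_ge0// lee_fin powR_ge0.
have aiS i : a i * (M i `^ r^-1)%:E <= S%:E.
  by apply: le_trans aS; exact: (le_esum_term (a := fun i => _)).
have afin i : a i \is a fin_num.
  rewrite ge0_fin_numE// ltNge leye_eq; apply/negP => /eqP ai.
  by have := aiS i; rewrite ai gt0_mulye ?lte_fin ?powR_gt0// leye_eq.
pose b i := (S `^ (r - 1) * (fine (a i) * M i `^ (r^-1 - 1)))%R.
have fa0 i : (0 <= fine (a i))%R by exact: fine_ge0.
have b0 i : (0 <= b i)%R by rewrite !mulr_ge0// powR_ge0.
have hb x : D x -> (h x)%:E <= \esum_(i in [set: T]) ((b i)%:E * (\1_(A i) x)%:E).
  move=> Dx; pose s := (h x `^ r^-1)%R.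
  have s0 : (0 <= s)%R by exact: powR_ge0.
  have sr : (s `^ r = h x)%R by rewrite -powRrM mulVf ?gt_eqF// powRr1.
  (* The tangent inequality at [s], applied to [S / M i `^ r^-1] and scaled by
     the weight [a i * M i `^ r^-1 / S]; these weights have sum at most 1. *)
  have step i : ((r * s `^ (r - 1))%:E * a i <=
      (b i)%:E + ((r - 1) * h x / S)%:E * (a i * (M i `^ r^-1)%:E)).
    rewrite -(fineK (afin i)) -!EFinM -EFinD lee_fin.
    have Mp : (0 < M i `^ r^-1)%R by exact: powR_gt0.
    have := powR_tangent r1 s0 (ltW (divr_gt0 S0 Mp)); rewrite sr => H.
    have E : ((S / M i `^ r^-1) `^ r = S `^ r / M i)%R.
      rewrite powRM ?invr_ge0 ?ltW// -powR_inv1 ?ltW// -!powRrM.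
      by rewrite mulN1r mulrN mulVf ?gt_eqF// powR_inv1 ?ltW.
    have w0 : (0 <= fine (a i) * M i `^ r^-1 / S)%R.
      by rewrite divr_ge0 ?mulr_ge0 ?(ltW S0) ?(ltW Mp).
    move: H; rewrite E => /(ler_wpM2l w0); congr (_ <= _)%R.
      by field; rewrite !gt_eqF.
    have Sr : (S `^ (r - 1) = S `^ r / S)%R.
      by rewrite powRB ?(gt_eqF S0) ?implybT// powRr1 ?ltW.
    have Mr : (M i `^ (r^-1 - 1) = M i `^ r^-1 / M i)%R.
      by rewrite powRB ?(gt_eqF (M0 i)) ?implybT// powRr1 ?ltW.
    by rewrite /b Sr Mr; field; rewrite !gt_eqF.
  have hr : (r * s `^ (r - 1))%:E * (h x `^ r^-1)%:E = (r * h x)%:E.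
    by rewrite -EFinM -mulrA [(_ * h x `^ _)%R]mulrC mulr_powRB1// sr.
  have c0 : (0 <= (r - 1) * h x / S)%R.
    by rewrite divr_ge0 ?mulr_ge0 ?subr_ge0// ltW.
  have rs0 : 0 <= (r * s `^ (r - 1))%:E by rewrite lee_fin mulr_ge0 ?powR_ge0// ltW.
  (* The inequalities [step] are summed over the sets containing [x]. By [ha] the left side becomes
     at least r h(x); the remainder on the right is at most (r - 1) h(x) and is cancelled
     afterwards. *)
  have H : (r * h x)%:E <= \esum_(i in [set i | A i x]) (b i)%:E + ((r - 1) * h x)%:E.
    rewrite -hr; apply: le_trans (lee_wpmul2l rs0 (ha x Dx)) _.
    rewrite -esumZl//; apply: le_trans; first by apply: le_esum => i _; exact: step.
    rewrite esumD; last 2 first.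
    - by move=> i _; rewrite lee_fin.
    - by move=> i _; rewrite mule_ge0.
    apply: leeD => //; rewrite esumZl//.
    apply: (@le_trans _ _ (((r - 1) * h x / S)%:E * S%:E)).
      apply: lee_wpmul2l; first by rewrite lee_fin.
      by apply: le_trans aS; exact: subset_le_esum.
    by rewrite -EFinM divfK// gt_eqF.
  have -> : \esum_(i in [set: T]) ((b i)%:E * (\1_(A i) x)%:E) =
      \esum_(i in [set i | A i x]) (b i)%:E.
    rewrite [RHS]esum_mkcond; apply: eq_esum => i _; rewrite indicE.
    by rewrite (_ : (i \in [set i | A i x]) = (x \in A i)) ?inE//;
      case: ifPn; rewrite ?mule1 ?mule0.
  rewrite -(@leeD2rE _ ((r - 1) * h x)%:E)// -EFinD.
  by rewrite (_ : h x + (r - 1) * h x = r * h x)%R//; ring.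
apply: (@le_trans _ _ (\int[mu]_(x in D)
    \esum_(i in [set: T]) ((b i)%:E * (\1_(A i) x)%:E))).
  apply: ge0_le_integral => //.
  - by move=> x _; rewrite lee_fin.
  - exact/measurable_EFinP.
  - apply: ge0_emeasurable_esum => [i|i x]; last by rewrite mule_ge0// lee_fin.
    by apply: measurable_funeM; exact: measurable_indic_EFin.
rewrite ge0_integral_esum//; last 2 first.
- by move=> i; by apply: measurable_funeM; exact: measurable_indic_EFin.
- by move=> i x; rewrite mule_ge0// lee_fin.
apply: (@le_trans _ _ (\esum_(i in [set: T])
    ((S `^ (r - 1))%:E * (a i * (M i `^ r^-1)%:E)))).
  apply: le_esum => i _; rewrite ge0_integralZl//; last 2 first.
  - exact: measurable_indic_EFin.
  - by rewrite lee_fin.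
  rewrite integral_indic//.
  apply: (@le_trans _ _ ((b i)%:E * (M i)%:E)).
    apply: lee_wpmul2l; first by rewrite lee_fin.
    by apply: le_trans (muA i); apply: le_measure; rewrite ?inE//; exact: measurableI.
  rewrite -(fineK (afin i)) -!EFinM lee_fin /b -!mulrA.
  rewrite ler_wpM2l ?powR_ge0// ler_wpM2l//.
  by rewrite mulrC mulr_powRB1// ?ltW// invr_gt0.
rewrite esumZl ?lee_fin ?powR_ge0//.
apply: (@le_trans _ _ ((S `^ (r - 1))%:E * S%:E)).
  by apply: lee_wpmul2l; rewrite ?lee_fin ?powR_ge0.
by rewrite -EFinM mulrC mulr_powRB1// ltW.
Qed.

End jensen.

(** * Discretization of the Choquet integral *)

Section atomic_decomposition.
Context {R : realType} {n : nat}.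
Local Notation cube := (@dyadic_cube R n).
Local Notation side := (@dyadic_side R n).
Local Notation mu := (@lebesgue_rV R n).

Lemma exists_dyadic_scale (r : R) : (0 < r)%R ->
  exists k : int, (2 ^ k < r <= 2 ^ (k + 1))%R.
Proof.
move=> r0; have ln2 : (0 < ln 2 :> R)%R by rewrite ln_gt0// ltr1n.
have E (k : int) : (2 ^ k = expR (k%:~R * ln 2) :> R)%R.
  by rewrite -powR_intmul// /powR gt_eqF.
exists (Num.ceil (ln r / ln 2) - 1)%R; rewrite subrK !E -{2 3}(lnK r0).
rewrite ltr_expR ler_expR -ltr_pdivlMr// -ler_pdivrMr// ceil_ge andbT.
exact: ceilB1_lt.
Qed.

Lemma nonincreasing_emeasurable (D : set R) (f : R -> \bar R) :
  measurable D -> {homo f : x y / (x <= y)%R >-> y <= x} -> measurable_fun D f.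
Proof.
move=> mD ni; apply: (measurability _ (ErealGenOInfty.measurableE R)) => //.
move=> _ [_ [r ->] <-]; apply: measurableI => //.
apply: is_interval_measurable => x y /= xr yr z /andP[xz zy].
move: yr; rewrite !in_itv/= !andbT => yr.
by apply: lt_le_trans yr _; exact: ni.
Qed.

Lemma cube_avg1 Q : 0 < mu (cube Q) -> cube_avg (fun=> 1%R : R) Q = 1.
Proof.
move=> mQ0; rewrite /cube_avg integral_cst; last exact: measurable_dyadic_cube.
rewrite mul1e mulVe ?gt_eqF//.
by rewrite ge0_fin_numE ?lebesgue_dyadic_cube_lty// ltW.
Qed.

(** The intervals ]2^(k-1), 2^k] are disjoint and have length 2^(k-1), and on each of them the
    content of the level set is at least its value at 2^k. *)
Lemma esum_le_choquet_integral (d : R) (F : Rn R n -> \bar R) :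
  \esum_(k in [set: int]) ((2 ^ (k - 1) : R)%:E *
    weighted_content d (fun=> 1%R) [set x | (2 ^ k : R)%:E < F x])
  <= choquet_integral d F.
Proof.
pose phi t := weighted_content d (fun=> 1%R) [set x | t%:E < F x].
have two0 (k : int) : (0 < 2 ^ k :> R)%R by rewrite exprz_gt0.
have avg0 Q : 0 <= cube_avg (fun=> 1%R : R) Q * (side Q `^ d)%:E.
  by rewrite !mule_ge0 ?inve_ge0 ?lee_fin ?powR_ge0//; apply: integral_ge0.
have phi0 t : 0 <= phi t by exact: cover_cost_ge0.
have phi_ni : {homo phi : x y / (x <= y)%R >-> y <= x}.
  by move=> x y xy; apply: le_cover_cost => z /=; apply: le_lt_trans; rewrite lee_fin.
have mphi (D : set R) : measurable D -> measurable_fun D phi.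
  by move=> mD; exact: nonincreasing_emeasurable.
apply: ge_ereal_sup => _ [X [finX _] <-]; rewrite fsbig_finite//=.
pose J (k : int) : set R := `]2 ^ (k - 1), 2 ^ k]%classic.
have tJ : trivIset [set` finmap.enum_fset (fset_set X)] J.
  have wlogJ (k l : int) x : J k x -> J l x -> (k <= l)%R.
    rewrite /J /= !in_itv/= => /andP[k1 k2] /andP[l1 l2].
    rewrite leNgt; apply/negP => lk.
    have : (2 ^ l <= 2 ^ (k - 1) :> R)%R by rewrite ler_weXz2l ?ler1n// lerBrDr lezD1.
    by rewrite leNgt (lt_le_trans k1 l2).
  move=> k l _ _ [x [Jk Jl]]; apply/eqP; rewrite eq_le.
  by rewrite (wlogJ k l x)// (wlogJ l k x).
have step (k : int) : (2 ^ (k - 1) : R)%:E * phi (2 ^ k)%R <=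
    \int[lebesgue_measure]_(t in J k) phi t.
  apply: (@le_trans _ _ (\int[lebesgue_measure]_(t in J k) cst (phi (2 ^ k)%R) t)).
    have kE : (2 ^ k = 2 * 2 ^ (k - 1) :> R)%R.
      by rewrite -[X in (X * _)%R]expr1z -expfzDr// addrC subrK.
    have mJ : lebesgue_measure (J k) = (2 ^ k - 2 ^ (k - 1))%:E :> \bar R.
      rewrite lebesgue_measure_itv/= lte_fin.
      by rewrite kE ltr_pMl// ?ltr1n// -EFinB.
    rewrite integral_cst; last exact: measurable_itv.
    rewrite [X in _ <= _ * X]mJ kE muleC (_ : 2 * _ - _ = 2 ^ (k - 1))%R//.
    by ring.
  apply: ge0_le_integral.
  - exact: measurable_itv.
  - by move=> t _; exact: phi0.
  - exact: measurable_cst.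
  - by apply: mphi; exact: measurable_itv.
  - by move=> t; rewrite /J/= in_itv/= => /andP[_ tk]; exact: phi_ni.
apply: le_trans; first by apply: lee_sum => k _; exact: step.
have mU : measurable (\big[setU/set0]_(k <- finmap.enum_fset (fset_set X)) J k).
  by apply: bigsetU_measurable => k _; exact: measurable_itv.
rewrite -ge0_integral_bigsetU//; last 3 first.
- by move=> k; exact: measurable_itv.
- exact: finmap.fset_uniq.
- exact: mphi.
apply: ge0_subset_integral => //.
- by apply: mphi; exact: measurable_itv.
- move=> t; rewrite -bigcup_seq => -[k _]; rewrite /J/= !in_itv/= andbT => /andP[+ _].
  exact: lt_trans.
Qed.

(** A point with 2^k < F(x) <= 2^(k+1) lies in a cube of the k-th covering, whose coefficient is at
    least 2^(k+1). The constant 4 is the ratio of 2^(k+1) to the length 2^(k-1) available at that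
    level in the Choquet integral. *)
Lemma atomic_decomposition (d eps : R) (F : Rn R n -> \bar R) :
  (forall Q, 0 < mu (cube Q)) -> (0 < eps)%R -> (forall x, 0 <= F x) ->
  choquet_integral d F < +oo ->
  exists lam : int * 'rV[int]_n -> \bar R,
  [/\ forall P, 0 <= lam P,
      \esum_(P in [set: int * 'rV[int]_n]) (lam P * (side P `^ d)%:E) <=
        4%:E * choquet_integral d F + eps%:E &
      forall x, F x <= \esum_(P in [set P | cube P x]) lam P].
Proof.
move=> muQ eps0 F0 Ify.
pose phi (k : int) := weighted_content d (fun=> 1%R) [set x | (2 ^ k : R)%:E < F x].
have two0 (k : int) : (0 < 2 ^ k :> R)%R by rewrite exprz_gt0.
have c1 Q : cube_avg (fun=> 1%R : R) Q * (side Q `^ d)%:E = (side Q `^ d)%:E.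
  by rewrite cube_avg1 ?mul1e.
have c10 Q : 0 <= cube_avg (fun=> 1%R : R) Q * (side Q `^ d)%:E.
  by rewrite c1 lee_fin powR_ge0.
have phi0 k : 0 <= phi k by exact: cover_cost_ge0.
have phiE0 (k : int) : 0 <= (2 ^ (k - 1) : R)%:E * phi k.
  by rewrite mule_ge0// lee_fin ltW.
have phifin k : phi k \is a fin_num.
  rewrite ge0_fin_numE// ltNge leye_eq; apply/negP => /eqP phiy.
  have := le_trans (le_esum_term (I : [set: int] k) (fun k _ => phiE0 k))
    (esum_le_choquet_integral d F).
  by rewrite -/(phi k) phiy gt0_muley ?lte_fin// leye_eq => /eqP Iy; rewrite Iy in Ify.
(* The error [eta k] gets multiplied by 2^(k+1); the products eps / 2^(pickle k + 1) add up to at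
   most [eps]. *)
pose eta (k : int) : R := (eps / (2 ^ (pickle k).+1)%:R / 2 ^ (k + 1))%R.
have eta0 k : (0 < eta k)%R by rewrite !divr_gt0// ltr0n expn_gt0.
pose K k (G : pred nat * (nat -> int * 'rV[int]_n)) :=
  [set x | (2 ^ k : R)%:E < F x] `<=` \bigcup_(i in [set i | G.1 i]) cube (G.2 i) /\
  \sum_(i <oo | G.1 i) (side (G.2 i) `^ d)%:E <= phi k + (eta k)%:E.
have [G GP] : {G : int -> pred nat * (nat -> int * 'rV[int]_n) & forall k, K k (G k)}.
  apply: (@choice _ _ K) => k.
  have [_ [D [H [DH ->]]] lt] := lb_ereal_inf_adherent (eta0 k) (phifin k).
  exists (D, H); split => //; apply: le_trans (ltW lt) => /=.
  by under [leRHS]eq_eseriesr do rewrite c1.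
pose C k : set (int * 'rV[int]_n) := (G k).2 @` [set i | (G k).1 i].
pose lam P := \esum_(k in [set k | C k P]) (2 ^ (k + 1) : R)%:E.
have lam_ge k P : C k P -> (2 ^ (k + 1) : R)%:E <= lam P.
  move=> CkP; apply: (le_esum_term (a := fun k : int => (2 ^ (k + 1) : R)%:E)) => //.
  by move=> i _; rewrite lee_fin ltW.
have lam0 P : 0 <= lam P by apply: esum_ge0 => k _; rewrite lee_fin ltW.
have lamx x k : (2 ^ k : R)%:E < F x ->
    (2 ^ (k + 1) : R)%:E <= \esum_(P in [set P | cube P x]) lam P.
  move=> /(GP k).1[i Gi xi].
  have := le_esum_term (A := [set P | cube P x]) xi (fun P _ => lam0 P).
  by apply: le_trans; apply: lam_ge; exists i.
exists lam; split => //.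
- have -> : \esum_(P in [set: int * 'rV[int]_n]) (lam P * (side P `^ d)%:E) =
      \esum_(k in [set: int]) ((2 ^ (k + 1) : R)%:E *
        \esum_(P in C k) (side P `^ d)%:E).
    transitivity (\esum_(P in [set: int * 'rV[int]_n]) \esum_(k in [set: int])
        if k \in [set k | C k P] then (side P `^ d)%:E * (2 ^ (k + 1) : R)%:E else 0).
      apply: eq_esum => P _; rewrite muleC /lam -esumZl ?lee_fin ?powR_ge0//.
        by rewrite esum_mkcond.
      by move=> k _; rewrite lee_fin ltW.
    rewrite exchange_esum; last first.
      by move=> P k _ _; case: ifP => // _; rewrite mule_ge0// lee_fin ?powR_ge0// ltW.
    apply: eq_esum => k _; rewrite -esumZl ?lee_fin ?ltW//.
      rewrite [RHS]esum_mkcond; apply: eq_esum => P _.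
      by rewrite (_ : (k \in [set k | C k P]) = (P \in C k)) ?inE// muleC.
    by move=> P _; rewrite lee_fin powR_ge0.
  apply: (@le_trans _ _ (\esum_(k in [set: int])
      (4%:E * ((2 ^ (k - 1) : R)%:E * phi k) + (eps / (2 ^ (pickle k).+1)%:R)%:E))).
    apply: le_esum => k _.
    apply: (@le_trans _ _ ((2 ^ (k + 1) : R)%:E * (phi k + (eta k)%:E))).
      apply: lee_wpmul2l; first by rewrite lee_fin ltW.
      apply: le_trans (GP k).2.
      rewrite nneseries_esum; last by move=> i _; rewrite lee_fin powR_ge0.
      by apply: esum_image_le => P; rewrite lee_fin powR_ge0.
    rewrite ge0_muleDr ?lee_fin ?(ltW (eta0 k))// muleA; apply: leeD.
      rewrite -EFinM (_ : 4 * 2 ^ (k - 1) = 2 ^ (k + 1))%R//.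
      by rewrite -{2}(subrK 1%R k) !expfzDr// !expr1z; ring.
    by rewrite -EFinM lee_fin /eta mulrCA divff ?gt_eqF// mulr1.
  rewrite esumD; last 2 first.
  - by move=> k _; rewrite mule_ge0.
  - by move=> k _; rewrite lee_fin ltW// divr_gt0// ltr0n expn_gt0.
  apply: leeD.
    rewrite esumZl//; apply: lee_wpmul2l => //.
    exact: esum_le_choquet_integral.
  rewrite -(@esum_image _ _ _ _ (@pickle int) (fun m => (eps / (2 ^ m.+1)%:R)%:E));
    last by move=> i j _ _; exact: (pcan_inj (@pickleK int)).
  have e0 m : 0 <= (eps / (2 ^ m.+1)%:R)%:E.
    by rewrite lee_fin ltW// divr_gt0// ltr0n expn_gt0.
  apply: (@le_trans _ _ (\esum_(m in [set: nat]) (eps / (2 ^ m.+1)%:R)%:E)).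
    exact: subset_le_esum.
  rewrite -nneseries_esumT//.
  exact: (epsilon_trick0 xpredT (ltW eps0)).
- move=> x; have := F0 x; rewrite le_eqVlt => /predU1P[<-|Fx0].
    by apply: esum_ge0.
  case Fx : (F x) Fx0 => [r| |]// r0.
    have [k /andP[k1 k2]] := exists_dyadic_scale r0.
    apply: (@le_trans _ _ (2 ^ (k + 1))%:E); rewrite ?lee_fin//.
    by apply: lamx; rewrite Fx lte_fin.
  (* Where [F] is [+oo], all level sets contain the point, so the sum exceeds every [y]; the maximum
     with 1 provides a positive number with a dyadic scale. *)
  rewrite leye_eq; apply/eqP/eq_infty => y.
  have y1 : (0 < Num.max y 1)%R by rewrite lt_max ltr01 orbT.
  have [k /andP[_ yk]] := exists_dyadic_scale y1.
  apply: le_trans (lamx x k _); last by rewrite Fx ltry.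
  by rewrite lee_fin (le_trans _ yk)// le_max lexx.
Qed.

End atomic_decomposition.

(** * Packing and covering *)

Section cover_cost_complements.
Context {R : realType} {T I : Type} (S : I -> set T) (c : I -> \bar R).
Hypothesis c0 : forall i, 0 <= c i.

Lemma cover_cost_le i (E : set T) : E `<=` S i -> cover_cost S c E <= c i.
Proof.
move=> ES; have <- : \sum_(k <oo | pred1 0%N k) c i = c i.
  rewrite nneseries_esum// (_ : [set x | pred1 0%N x] = [set 0%N]); last first.
    by apply/seteqP; split=> x /=; [move/eqP|move=> ->].
  by rewrite esum_set1.
apply: ereal_inf_lbound; exists (pred1 0%N), (fun=> i); split=> //.
by move=> x /ES Sx; exists 0%N.
Qed.

Lemma cover_cost_bigcup (J : countType) (D : set J) (A : J -> set T) :
  I -> cover_cost S c (\bigcup_(j in D) A j) <=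
    \esum_(j in D) cover_cost S c (A j).
Proof.
move=> i0; rewrite esum_mkcond esum_countType; last first.
  by move=> j; case: ifP => // _; exact: cover_cost_ge0.
pose B k := oapp (fun j => if j \in D then A j else set0) set0 (@pickle_inv J k).
apply: (@le_trans _ _ (cover_cost S c (\bigcup_k B k))).
  apply: le_cover_cost => x [j Dj Ax]; exists (pickle j) => //.
  by rewrite /B pickleK_inv/= mem_set.
apply: le_trans (cover_cost_sigma_subadditive S c0 B) _.
apply: lee_nneseries => [k _ _|k _]; first exact: cover_cost_ge0.
rewrite /B; case: pickle_inv => [j|] /=; last by rewrite cover_cost_set0.
by case: ifP => // _; rewrite cover_cost_set0.
Qed.

End cover_cost_complements.

(** * Packing families of dyadic cubes *)

Section packing.
Context {R : realType} {n : nat}.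
Hypothesis n0 : (0 < n)%N.
Local Notation T := (int * 'rV[int]_n)%type.
Local Notation cube := (@dyadic_cube R n).
Local Notation side := (@dyadic_side R n).
Implicit Types P Q G : T.

(** Through this, a bound on all finite sums passes to the union of a chain, as Zorn's lemma
    demands. *)
Lemma total_on_finite_bigcup (U : choiceType) (F : set (set U)) (X : set U) :
  total_on F subset -> finite_set X -> X `<=` \bigcup_(A in F) A ->
  X = set0 \/ exists2 A, F A & X `<=` A.
Proof.
move=> totF /finite_seqP[s ->{X}]; elim: s => [|x s IH] sF.
  by left; rewrite -subset0.
right; have [|A FA Ax] := sF x; first by rewrite /= mem_head.
have [|s0|[B FB sB]] := IH.
- by move=> y ys; apply: sF; rewrite /= inE ys orbT.
- exists A => // y; rewrite /= inE => /predU1P[-> //|ys].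
  by have : [set` s] y by []; rewrite s0.
- have [AB|BA] := totF A B FA FB.
    by exists B => // y; rewrite /= inE => /predU1P[->|/sB//]; exact: AB.
  by exists A => // y; rewrite /= inE => /predU1P[->//|/sB/BA].
Qed.

Lemma le_dyadic_side_powR (d : R) P Q : (0 <= d)%R -> cube P `<=` cube Q ->
  (side P `^ d <= side Q `^ d)%R.
Proof.
move=> d0 PQ; apply: ge0_ler_powR; rewrite ?nnegrE ?(ltW (dyadic_side_gt0 _))//.
exact/le_dyadic_side/(dyadic_cube_sub_le n0 PQ).
Qed.

(* The greedy selection of Orobitg and Verdera, obtained here from Zorn's lemma. *)
Lemma exists_packing (d : R) (B : set T) : (0 <= d)%R ->
  exists S : set T, [/\ S `<=` B,
    forall Q, \esum_(P in S `&` [set P | cube P `<=` cube Q]) (side P `^ d)%:E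
      <= (2 * side Q `^ d)%:E &
    forall P, B P -> ~ S P -> exists2 Q, cube P `<=` cube Q &
      (side Q `^ d)%:E <=
        \esum_(P' in S `&` [set P' | cube P' `<=` cube Q]) (side P' `^ d)%:E].
Proof.
move=> d0; pose packed S := S `<=` B /\ forall Q,
  \esum_(P in S `&` [set P | cube P `<=` cube Q]) (side P `^ d)%:E
    <= (2 * side Q `^ d)%:E.
have sd0 P : 0 <= (side P `^ d)%:E by rewrite lee_fin powR_ge0.
have [F FP totF|S [[SB packS] maxS]] := @Zorn_bigcup T packed.
  split=> [P [S FS SP]|Q]; first exact: (FP S FS).1 SP.
  apply: ge_ereal_sup => _ [X [finX XS] <-].
  have [P /XS[]//|X0|[S FS XS']] := total_on_finite_bigcup totF finX.
    by rewrite X0 fsbig_set0 lee_fin mulr_ge0// powR_ge0.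
  apply: le_trans ((FP S FS).2 Q); apply: ereal_sup_ubound; exists X => //.
  by split=> // P XP; split; [exact: XS'|exact: (XS _ XP).2].
exists S; split=> // P BP nSP.
(* Otherwise [P] could be added to the maximal [S]: in any cube [Q] containing [P] the sum over [S]
   is below l(Q)^d and [P] adds at most l(Q)^d, whence the constant 2. *)
apply: contrapT => noQ; apply: (maxS (P |` S)).
  split; last by move=> SP; apply: nSP; apply: SP; left.
  by move=> Q SQ; right.
split=> [Q [->//|]|Q]; first exact: SB.
have [PQ|nPQ] := pselect (cube P `<=` cube Q); last first.
  apply: le_trans (packS Q); by apply: subset_le_esum => // P' [[->|SP'] P'Q].
apply: (@le_trans _ _ (\esum_(P' in P |` (S `&` [set P' | cube P' `<=` cube Q]))
    (side P' `^ d)%:E)).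
  by apply: subset_le_esum => // P' [[->|SP'] P'Q]; [left|right].
rewrite (esumID [set P]); last by [].
rewrite (_ : _ `&` [set P] = [set P]); last first.
  by apply/seteqP; split=> x; [case|move=> ->; split=> //; left].
rewrite esum_set1// mulr_natl mulr2n EFinD; apply: leeD.
  by rewrite lee_fin; exact: le_dyadic_side_powR.
apply: (@le_trans _ _ (\esum_(P' in S `&` [set P' | cube P' `<=` cube Q])
    (side P' `^ d)%:E)).
  by apply: subset_le_esum => // P' [[->|//] /(_ erefl)].
by rewrite leNgt; apply/negP => /ltW Qle; apply: noQ; exists Q.
Qed.

End packing.

(** * Covering by maximal good cubes *)

Section good_cubes.
Context {R : realType} {n : nat}.
Hypothesis n0 : (0 < n)%N.
Local Notation T := (int * 'rV[int]_n)%type.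
Local Notation cube := (@dyadic_cube R n).
Local Notation side := (@dyadic_side R n).
Local Notation sub P Q := (cube P `<=` cube Q).
Implicit Types P Q G : T.

(** As 2^N >= N, bounded sides keep the first index above [- N]. Shifted by [N] it becomes a natural
    number, and a cube where it is least is maximal. *)
Lemma dyadic_cube_maximal (A : set T) Q (N : nat) : A Q ->
  (forall G, A G -> sub Q G -> (side G < N%:R)%R) ->
  exists G, [/\ A G, sub Q G & forall G', A G' -> sub G G' -> G' = G].
Proof.
move=> AQ bnd.
have low G : A G -> sub Q G -> (- N%:Z < G.1)%R.
  move=> AG QG; rewrite ltNge; apply/negP => GN; have := bnd G AG QG.
  apply/negP; rewrite -leNgt /dyadic_side.
  apply: (@le_trans _ _ (2 ^+ N)%R).
    by rewrite -natrX ler_nat ltnW// ltn_expl.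
  by rewrite exprnP ler_weXz2l ?ler1n// lerNr.
pose p (m : nat) := `[< exists G, [/\ A G, sub Q G & G.1 = (m%:Z - N%:Z)%R] >].
have pabs G : A G -> sub Q G -> p (absz (G.1 + N%:Z)%R).
  move=> AG QG; apply/asboolP; exists G; split=> //.
  by rewrite gez0_abs ?addrK// -(opprK N%:Z) subr_ge0 ltW// low.
have pex : exists m, p m.
  by exists (absz (Q.1 + N%:Z)%R); exact: (pabs Q AQ (@subset_refl _ _)).
have [m /asboolP[G [AG QG Gm]] mmin] := ex_minnP pex.
exists G; split=> // G' AG' GG'; apply: dyadic_cube_inj; last first.
  by exists (dyadic_corner G); split; [apply/GG'|]; exact: dyadic_corner_mem.
apply/eqP; rewrite eq_le (dyadic_cube_sub_le n0 GG')/= Gm.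
have QG' : sub Q G' by exact: subset_trans GG'.
rewrite lerBlDr -(@gez0_abs (G'.1 + N%:Z)%R); last first.
  by rewrite -(opprK N%:Z) subr_ge0 ltW// low.
by rewrite lez_nat; exact/mmin/pabs.
Qed.

(** In the application [c] is the weighted cost, [m] the mass placed at a cube, [v] a lower bound
    for a function on the cube and [e] the supremum of its reciprocal there. *)
Lemma dyadic_cube_cover_content (c m e v : T -> \bar R) (b tau r : R)
    (good null : set T) :
  (1 <= r)%R -> (0 < tau)%R -> (0 < b)%R ->
  (forall G, 0 <= c G) -> (forall Q, 0 <= m Q) ->
  (forall Q, 0 <= e Q) -> (forall Q, 0 <= v Q) ->
  \esum_(Q in [set: T]) m Q < +oo ->
  (forall P Q, sub P Q -> e P <= e Q) -> (forall Q, v Q * e Q <= 1) ->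
  (forall Q, c Q <= (v Q * (side Q `^ b)%:E) `^ r) ->
  (forall Q, null Q -> c Q = 0) ->
  (forall G, good G -> e G < +oo /\
    (tau * side G `^ b)%:E <= \esum_(Q in [set Q | sub Q G]) (m Q * e Q)) ->
  cover_cost cube c (\bigcup_(G in good `|` null) cube G) <=
    ((tau^-1)%:E * \esum_(Q in [set: T]) m Q) `^ r.
Proof.
move=> r1 tau0 b0 c0 m0 e0 v0 mfin e_homo ve cle nullP goodP.
have r0 : (0 < r)%R by exact: lt_le_trans r1.
have me0 Q : 0 <= m Q * e Q by rewrite mule_ge0.
(* Multiply the lower bound by [v G]: each [v G * e Q] is at most [v G * e G <= 1], so only the
   masses remain. *)
have cost_le (X : set T) G s : (0 < s)%R -> (forall Q, X Q -> sub Q G) ->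
    (s * side G `^ b)%:E <= \esum_(Q in X) (m Q * e Q) ->
    c G <= ((s^-1)%:E * \esum_(Q in X) m Q) `^ r.
  move=> s0 XG sle; apply: (le_trans (cle G)); apply: lee_poweR2r; first exact: ltW.
    by rewrite mule_ge0// lee_fin powR_ge0.
  rewrite lee_pdivlMl// muleCA -EFinM.
  apply: (le_trans (lee_wpmul2l (v0 G) sle)).
  rewrite -esumZl//; apply: le_esum => Q XQ; rewrite muleCA.
  rewrite -[leRHS]mule1; apply: lee_wpmul2l => //; apply: le_trans (ve G).
  by apply: lee_wpmul2l => //; apply/e_homo/XG.
pose big : set T :=
  [set Q | forall N : nat, exists2 G, good G /\ sub Q G & (N%:R <= side G)%R].
have big0 Q0 : big Q0 -> cover_cost cube c (cube Q0) = 0.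
  move=> bigQ0; apply/eqP; rewrite eq_le cover_cost_ge0// andbT.
  apply/lee_addgt0Pr => eps eps0; rewrite add0e.
  (* [dl] satisfies dl^r = eps, and the mass outside [X] is at most dl tau / 2, which [cost_le] with
     constant tau / 2 turns into [dl]. *)
  pose dl := (eps `^ r^-1)%R; have dl0 : (0 < dl)%R by exact: powR_gt0.
  have [X finX Xle] := esum_remainder m0 mfin (mulr_gt0 dl0 (divr_gt0 tau0 (ltr0Sn R 1))).
  (* All cubes inside a good cube have finite [e] by monotonicity; restricting [X] to such cubes
     makes its contribution [D] finite. *)
  pose X' := X `&` [set Q | e Q < +oo].
  have Dfin : \esum_(Q in X') (m Q * e Q) \is a fin_num.
    have finX' : finite_set X' by exact: finite_setIl.
    rewrite esum_fset// fsbig_finite//=; apply/sum_fin_numP => Q.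
    rewrite in_fset_set// inE => -[XQ eQ] _.
    rewrite fin_numM// ge0_fin_numE//.
    by apply: le_lt_trans mfin; exact: le_esum_term.
  pose D := fine (\esum_(Q in X') (m Q * e Q)).
  have D0 : (0 <= D)%R by rewrite fine_ge0// esum_ge0.
  (* From side [M] on, [D] is at most half of tau l(G)^b, so the cubes outside [X] must supply the
     other half. *)
  pose M := ((2 * D / tau) `^ b^-1)%R.
  have [G [goodG Q0G] NG] := bigQ0 (Num.bound M).
  have [eG tG] := goodP G goodG.
  have sG : (D <= tau / 2 * side G `^ b)%R.
    have : ((2 * D / tau) <= side G `^ b)%R.
      have {1}<- : (M `^ b = 2 * D / tau)%R.
        rewrite -powRrM mulVf ?gt_eqF// powRr1// divr_ge0 ?mulr_ge0//.
        exact: ltW.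
      apply: ge0_ler_powR.
      - exact: ltW.
      - by rewrite nnegrE powR_ge0.
      - by rewrite nnegrE ltW// dyadic_side_gt0.
      - by apply: le_trans NG; exact/ltW/archi_boundP/powR_ge0.
    by rewrite ler_pdivrMr// => H; lra.
  apply: le_trans (cover_cost_le c0 Q0G) _.
  have := cost_le ([set Q | sub Q G] `&` ~` X) G (tau / 2)%R _ _ _.
  move=> /(_ (divr_gt0 tau0 (ltr0Sn R 1))) H.
  apply: le_trans (H _ _) _ => [Q []//||].
    rewrite -(@leeD2lE _ D%:E)// -EFinD.
    apply: (@le_trans _ _ (tau * side G `^ b)%:E).
      by rewrite lee_fin; lra.
    apply: (le_trans tG); rewrite (esumID X)//; apply: leeD => //.
    rewrite fineK//; apply: subset_le_esum => // Q [QG XQ]; split=> //=.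
    exact: le_lt_trans (e_homo _ _ QG) eG.
  apply: (@le_trans _ _ (dl%:E `^ r)).
    apply: lee_poweR2r; first exact: ltW.
      by rewrite mule_ge0 ?esum_ge0// lee_fin invr_ge0 divr_ge0// ltW.
    rewrite lee_pdivrMl ?divr_gt0// -EFinM mulrC; apply: le_trans Xle.
    by apply: subset_le_esum => // Q [].
  by rewrite poweR_EFin /dl -powRrM mulVf ?gt_eqF// powRr1// ltW.
pose mx : set T := [set G | good G /\ forall G', good G' -> sub G G' -> G' = G].
pose J := mx `|` (big `|` null).
have Jcover : \bigcup_(G in good `|` null) cube G `<=` \bigcup_(G in J) cube G.
  move=> x [Q [goodQ|nullQ] Qx]; last by exists Q => //; right; right.
  have [bigQ|/existsNP[N nbig]] := pselect (big Q); first by exists Q => //; right; left.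
  have [|G [goodG QG Gmax]] := @dyadic_cube_maximal good Q N goodQ.
    move=> G goodG QG; rewrite ltNge; apply/negP => NG; apply: nbig.
    by exists G.
  by exists G; [left|exact: QG].
have i0 : T by exact: (0, 0)%R.
apply: le_trans (@le_cover_cost _ _ _ cube c _ _ Jcover) _.
apply: le_trans (cover_cost_bigcup cube c0 J cube i0) _.
apply: (@le_trans _ _ (\esum_(G in mx) c G)).
  rewrite esum_mkcond [leRHS]esum_mkcond; apply: le_esum => G _.
  case: ifPn => [/set_mem JG|_]; last by case: ifP.
  case: ifPn => [_|/negP nmx]; first exact: cover_cost_le.
  case: JG => [mxG|[/big0 ->//|/nullP cG]]; first by exfalso; apply: nmx; rewrite inE.
  by rewrite -cG; exact: cover_cost_le.
apply: (@le_trans _ _ (\esum_(G in mx)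
    ((tau^-1)%:E * \esum_(Q in [set Q | sub Q G]) m Q) `^ r)).
  apply: le_esum => G [goodG _]; apply: cost_le => //; exact: (goodP G goodG).2.
apply: le_trans (esum_poweR_le r1 _) _ => [G _|].
  by rewrite mule_ge0 ?esum_ge0// lee_fin invr_ge0 ltW.
apply: lee_poweR2r; first exact: ltW.
  by apply: esum_ge0 => G _; rewrite mule_ge0 ?esum_ge0// lee_fin invr_ge0 ltW.
rewrite esumZl; last 2 first.
- by rewrite lee_fin invr_ge0 ltW.
- by move=> G _; exact: esum_ge0.
apply: lee_wpmul2l; first by rewrite lee_fin invr_ge0 ltW.
(* A cube inside two maximal good cubes makes them nested, hence equal. *)
apply: esum_disjoint_le => // G G' [goodG mG] [goodG' mG'] [Q [/= QG QG']].
have x1 := dyadic_corner_mem (R := R) Q.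
have [GG'|/ltW GG'] := leP G.1 G'.1.
  apply: mG' => //; apply: dyadic_cube_nested => //.
  by exists (dyadic_corner Q); split; [exact: QG'|exact: QG].
apply/esym/mG => //; apply: dyadic_cube_nested => //.
by exists (dyadic_corner Q); split; [exact: QG|exact: QG'].
Qed.

End good_cubes.

(** * The weak-type inequality *)

Section cube_estimate.
Context {R : realType} {n : nat}.
Local Notation T := (int * 'rV[int]_n)%type.
Local Notation cube := (@dyadic_cube R n).
Local Notation side := (@dyadic_side R n).
Local Notation mu := (@lebesgue_rV R n).
Local Notation sub P Q := (cube P `<=` cube Q).

(** This is e_P of the overview when [u] is the power p/q of the maximal function of the weight. The
    inverse is [+oo] at 0 and 0 at [+oo]. *)
Definition sup_inv (u : Rn R n -> \bar R) (Q : T) : \bar R :=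
  ereal_sup [set (u x)^-1 | x in cube Q].

Lemma sup_inv_ge u Q x : cube Q x -> (u x)^-1 <= sup_inv u Q.
Proof. by move=> Qx; apply: ereal_sup_ubound; exists x. Qed.

Lemma sup_inv_ge0 u Q : (forall x, 0 <= u x) -> 0 <= sup_inv u Q.
Proof.
move=> u0; apply: le_trans (sup_inv_ge u (dyadic_corner_mem Q)).
by rewrite inve_ge0.
Qed.

Lemma le_sup_inv u P Q : sub P Q -> sup_inv u P <= sup_inv u Q.
Proof. by move=> PQ; apply: le_ereal_sup => _ [x Px <-]; exists x => //; exact: PQ. Qed.

Lemma mul_sup_inv_le1 u (v : \bar R) Q : 0 <= v ->
  (forall x, cube Q x -> v <= u x) -> v * sup_inv u Q <= 1.
Proof.
move=> v0 vu; have [->|vn0] := eqVneq v 0; first by rewrite mul0e.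
have H : sup_inv u Q <= v^-1.
  apply: ge_ereal_sup => _ [x Qx <-]; rewrite lee_pV2 ?inE ?vu//.
  exact: le_trans (vu x Qx).
apply: (le_trans (lee_wpmul2l v0 H)).
have [vfin|] := boolP (v \is a fin_num); first by rewrite muleC mulVe.
by rewrite ge0_fin_numE// -leNgt leye_eq => /eqP ->; rewrite invey mule0.
Qed.

Let le_mul_inv (s dl : R) (y : \bar R) : (0 <= s)%R -> (0 < dl)%R -> 0 < y ->
  s%:E <= (y^-1 + dl%:E) * (s%:E * y).
Proof.
move=> s0 dl0; case: y => [y| |]// y0.
- rewrite inver gt_eqF// -EFinD -!EFinM lee_fin.
  rewrite mulrDl mulrCA mulVf ?gt_eqF// mulr1 lerDl.
  by rewrite !mulr_ge0// ltW.
- rewrite invey add0e; have [->|sn0] := eqVneq s 0%R; first by rewrite mul0e mule0.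
  by rewrite gt0_muley ?lte_fin ?lt_def ?sn0// gt0_muley ?lte_fin// leey.
Qed.

(** If the right side plus some [eps] were below t^p l(Q)^b, then Jensen's bound with exponent 1/p,
    applied on [Q] to |f|^p <= u^(-1) sum_P lam_P 1_P, would contradict the lower bound on the
    integral of |f|. *)
Lemma dyadic_cube_estimate (kappa p d alpha b t : R) (L : R)
    (lam : T -> \bar R) (u : Rn R n -> \bar R) (f : Rn R n -> R) Q :
  (0 < kappa)%R -> (forall P, mu (cube P) = (kappa * side P ^+ n)%:E) ->
  (0 < p <= 1)%R -> d = (n%:R * p)%R -> b = (p * (n%:R - alpha))%R -> (0 < t)%R ->
  (0 < n)%N -> (0 < L)%R ->
  (forall P, 0 <= lam P) -> measurable_fun [set: Rn R n] f ->
  \esum_(P in [set: T]) (lam P * (side P `^ d)%:E) <= L%:E ->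
  (forall x, 0 <= u x) -> (forall x, cube Q x -> 0 < u x) ->
  (forall x, (`|f x| `^ p)%:E * u x <= \esum_(P in [set P | cube P x]) lam P) ->
  (t * (kappa * side Q `^ (n%:R - alpha)))%:E < \int[mu]_(x in cube Q) `|f x|%:E ->
  (t `^ p * side Q `^ b)%:E <=
    \esum_(P in [set P | sub P Q]) (lam P * (side P `^ d)%:E * sup_inv u P) +
    (side Q `^ d)%:E * sup_inv u Q * \esum_(P in [set P | sub Q P]) lam P.
Proof.
move=> k0 muE /andP[p0 p1] dE bE t0 n0 L0 lam0 mf lamL u0 uQ Fle.
move=> ltf.
set X := \esum_(P in _) _; set Y := _ * _.
have l0 P : (0 < side P)%R by exact: dyadic_side_gt0.
have e0 P : 0 <= sup_inv u P by exact: sup_inv_ge0.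
have ld0 P : 0 <= (side P `^ d)%:E by rewrite lee_fin powR_ge0.
have kp0 : (0 < kappa `^ p)%R by exact: powR_gt0.
have kl P : ((kappa * side P ^+ n) `^ p = kappa `^ p * side P `^ d)%R.
  rewrite powRM ?ltW// ?exprn_gt0//; congr (_ * _)%R.
  by rewrite -powR_mulrn ?ltW// -powRrM dE.
apply/lee_addgt0Pr => eps eps0; rewrite leNgt; apply/negP => ltX.
(* The term [dl] in the coefficients [a] covers the points where [u x = +oo]
   and [(u x)^-1] loses all information. *)
pose dl := (eps / L)%R; have dl0 : (0 < dl)%R by exact: divr_gt0.
(* Cubes inside [Q] keep their own set and supremum; strictly larger cubes are cut down to [Q] and
   use the supremum over [Q]. *)
pose inQ P := `[< sub P Q >]; pose onQ P := `[< sub Q P >].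
pose E P := if inQ P then sup_inv u P else sup_inv u Q.
pose a P := if inQ P || onQ P then lam P * (E P + dl%:E) else 0.
pose A P : set (Rn R n) := if inQ P then cube P else if onQ P then cube Q else set0.
pose M P := (kappa * (if inQ P then side P else side Q) ^+ n)%R.
pose S := ((t * (kappa * side Q `^ (n%:R - alpha))) `^ p)%R.
have tk0 : (0 < t * (kappa * side Q `^ (n%:R - alpha)))%R by rewrite !mulr_gt0// powR_gt0.
have SE : (S = kappa `^ p * (t `^ p * side Q `^ b))%R.
  rewrite /S !powRM ?mulr_ge0 ?powR_ge0// ?ltW// -powRrM bE.
  by rewrite [(p * _)%R]mulrC mulrCA.
have a0 P : 0 <= a P.
  rewrite /a; case: ifP => // _; rewrite mule_ge0// adde_ge0 ?lee_fin ?(ltW dl0)//.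
  by rewrite /E; case: ifP.
have := @integral_le_esum_powR R _ _ mu T (cube Q) A a M (fun x => `|f x|%R) p^-1 S.
move=> H; move: ltf; apply/negP; rewrite -leNgt.
have -> : (t * (kappa * side Q `^ (n%:R - alpha)) = S `^ p^-1)%R.
  by rewrite /S -powRrM mulfV ?gt_eqF// powRr1// ltW.
apply: H.
- by rewrite invf_ge1.
- exact: measurable_dyadic_cube.
- move=> P; rewrite /A; case: ifP => _; first exact: measurable_dyadic_cube.
  by case: ifP => _ //; exact: measurable_dyadic_cube.
- move=> P; rewrite /A /M; case: ifP => _; first by rewrite -muE; exact: lexx.
  case: ifP => _; first by rewrite -muE; exact: lexx.
  by rewrite measure0 lee_fin mulr_ge0// ?exprn_ge0 ?ltW.
- by move=> P; rewrite mulr_gt0// exprn_gt0//; case: ifP.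
- exact: a0.
- exact: powR_gt0.
- apply: measurable_funTS; apply: (measurableT_comp (@normr_measurable R setT)).
  exact: mf.
- by move=> x; exact: normr_ge0.
- move=> x Qx; rewrite invrK.
  apply: le_trans (le_mul_inv (powR_ge0 _ _) dl0 (uQ x Qx)) _.
  have ux0 : 0 <= (u x)^-1 + dl%:E by rewrite adde_ge0 ?inve_ge0 ?lee_fin ?(ltW dl0).
  apply: (le_trans (lee_wpmul2l ux0 (Fle x))).
  rewrite -esumZl//.
  have inon P : cube P x -> inQ P || onQ P.
    move=> Px; have [PQ|/ltW PQ] := leP Q.1 P.1; apply/orP; [left|right]; apply/asboolP;
    by apply: dyadic_cube_nested => //; exists x.
  apply: (@le_trans _ _ (\esum_(P in [set P | cube P x]) a P)).
    apply: le_esum => P Px; rewrite /a inon// muleC.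
    apply: lee_wpmul2l => //; apply: leeD => //.
    by rewrite /E; case: ifP => _; exact: sup_inv_ge.
  apply: subset_le_esum => // P Px; have := inon P Px; rewrite /A /=.
  by case: ifP => //= _ ->.
- rewrite invrK.
  (* [X] and [Y] collect the subcubes and the ancestors of [Q]; the terms with [dl] add at most dl L
     = eps. *)
  apply: (@le_trans _ _ ((kappa `^ p)%:E * (X + Y + eps%:E))); last first.
    rewrite SE EFinM; apply: lee_wpmul2l; first by rewrite lee_fin ltW.
    exact: ltW.
  pose onS : set T := [set P | sub Q P].
  pose inS : set T := [set P | sub P Q].
  have XE : X = \esum_(P in [set: T])
      if P \in inS then lam P * (side P `^ d)%:E * sup_inv u P else 0.
    by rewrite /X esum_mkcond.
  have YE : Y = \esum_(P in [set: T])
      if P \in onS then (side Q `^ d)%:E * sup_inv u Q * lam P else 0.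
    by rewrite /Y -esumZl ?mule_ge0// esum_mkcond.
  apply: (@le_trans _ _ (\esum_(P in [set: T]) ((kappa `^ p)%:E *
     ((if P \in inS then lam P * (side P `^ d)%:E * sup_inv u P else 0) +
      (if P \in onS then (side Q `^ d)%:E * sup_inv u Q * lam P else 0) +
      dl%:E * (lam P * (side P `^ d)%:E))))).
    apply: le_esum => P _.
    have split x y c : 0 <= x -> 0 <= y -> (0 <= c)%R ->
        x * (y + dl%:E) * (kappa `^ p * c)%:E =
        (kappa `^ p)%:E * (x * c%:E * y + dl%:E * (x * c%:E)).
      move=> x0 y0 c0; rewrite (EFinM _ c) [LHS]muleCA; congr (_ * _).
      by rewrite muleAC ge0_muleDr ?lee_fin ?(ltW dl0)// [dl%:E * _]muleC.
    have lamld0 P' : 0 <= lam P * (side P' `^ d)%:E by rewrite mule_ge0.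
    rewrite /a /M /E /inQ /onQ; case: asboolP => [inP|ninP];
      last case: asboolP => [onP|nonP].
    - rewrite /= kl split ?powR_ge0//= [_ \in inS]mem_set//.
      apply: lee_wpmul2l; first by rewrite lee_fin ltW.
      rewrite -addeA; apply: leeD => //; rewrite leeDr//.
      by case: ifP => // _; rewrite !mule_ge0.
    - rewrite /= kl split ?powR_ge0//= [_ \in inS]memNset// [_ \in onS]mem_set// add0e.
      apply: lee_wpmul2l; first by rewrite lee_fin ltW.
      apply: leeD; first by rewrite [leRHS]muleC muleA.
      apply: lee_wpmul2l; first by rewrite lee_fin ltW.
      apply: lee_wpmul2l => //; rewrite lee_fin.
      by apply: le_dyadic_side_powR => //; rewrite dE mulr_ge0// ltW.
    - rewrite /= mul0e mule_ge0// ?lee_fin ?(ltW kp0)// !adde_ge0//.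
      + by case: ifP => // _; rewrite !mule_ge0.
      + by case: ifP => // _; rewrite !mule_ge0.
      + by rewrite mule_ge0// lee_fin ltW.
  rewrite esumZl ?lee_fin ?(ltW kp0)//; last first.
    move=> P _; rewrite !adde_ge0//; [by case: ifP => // _; rewrite !mule_ge0..|].
    by rewrite !mule_ge0// lee_fin ltW.
  apply: lee_wpmul2l; first by rewrite lee_fin ltW.
  rewrite !esumD; last 4 first.
  - by move=> P _; case: ifP => // _; rewrite !mule_ge0.
  - by move=> P _; case: ifP => // _; rewrite !mule_ge0.
  - by move=> P _; rewrite !adde_ge0//; by case: ifP => // _; rewrite !mule_ge0.
  - by move=> P _; rewrite !mule_ge0// lee_fin ltW.
  rewrite -XE -YE; apply: leeD => //.
  rewrite esumZl ?lee_fin ?(ltW dl0)//; last by move=> P _; rewrite mule_ge0.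
  apply: (@le_trans _ _ (dl%:E * L%:E)).
    by apply: lee_wpmul2l; rewrite ?lee_fin ?(ltW dl0).
  by rewrite -EFinM divfK// gt_eqF.
Qed.

End cube_estimate.

(** * From the selected cubes to the content of the level set *)

Section weak_type.
Context {R : realType} {n : nat}.
Local Notation T := (int * 'rV[int]_n)%type.
Local Notation cube := (@dyadic_cube R n).
Local Notation side := (@dyadic_side R n).
Local Notation mu := (@lebesgue_rV R n).
Local Notation sub P Q := (cube P `<=` cube Q).

(** Every cube of [fam] lies in a cube that is good for the masses [m], and the content of the good
    cubes is controlled by the total mass. Membership in [pos] makes [v] positive, hence [sup_inv u]
    finite. *)
Lemma weak_type_content (kappa p d alpha b t r : R) (L : R)
    (lam c v : T -> \bar R) (u : Rn R n -> \bar R) (f : Rn R n -> R)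
    (pos fam null : set T) :
  (0 < kappa)%R -> (forall P, mu (cube P) = (kappa * side P ^+ n)%:E) ->
  (0 < p <= 1)%R -> d = (n%:R * p)%R -> b = (p * (n%:R - alpha))%R ->
  (0 <= alpha < n%:R)%R -> (0 < t)%R -> (1 <= r)%R -> (0 < n)%N -> (0 < L)%R ->
  (forall P, 0 <= lam P) -> measurable_fun [set: Rn R n] f ->
  \esum_(P in [set: T]) (lam P * (side P `^ d)%:E) <= L%:E ->
  (forall x, 0 <= u x) ->
  (forall x, (`|f x| `^ p)%:E * u x <= \esum_(P in [set P | cube P x]) lam P) ->
  (forall Q, 0 <= c Q) -> (forall Q, 0 <= v Q) ->
  (forall Q x, cube Q x -> v Q <= u x) ->
  (forall Q, c Q <= (v Q * (side Q `^ b)%:E) `^ r) ->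
  (forall Q, null Q -> c Q = 0) ->
  (forall P Q, sub P Q -> pos P -> pos Q) -> (forall Q, pos Q -> 0 < v Q) ->
  (forall Q, fam Q -> pos Q /\
    (t * (kappa * side Q `^ (n%:R - alpha)))%:E < \int[mu]_(x in cube Q) `|f x|%:E) ->
  cover_cost cube c (\bigcup_(Q in fam `|` null) cube Q) <=
    ((6 * L / t `^ p)%:E) `^ r.
Proof.
move=> k0 muE p01 dE bE /andP[alpha0 alphan] t0 r1 n0 L0 lam0 mf lamL u0 Fle.
move=> c0 v0 vu cle nullP posS posv famP.
have /andP[p0 _] := p01; have r0 : (0 < r)%R by exact: lt_le_trans r1.
have d0 : (0 <= d)%R by rewrite dE mulr_ge0// ltW.
have b0 : (0 < b)%R by rewrite bE mulr_gt0// subr_gt0.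
have l0 P : (0 < side P)%R by exact: dyadic_side_gt0.
have e0 P : 0 <= sup_inv u P by exact: sup_inv_ge0.
have ld0 P : 0 <= (side P `^ d)%:E by rewrite lee_fin powR_ge0.
have tp0 : (0 < t `^ p)%R by exact: powR_gt0.
have [tau tauE] : exists tau, tau = (t `^ p / 2)%R by eexists.
have tau0 : (0 < tau)%R by rewrite tauE divr_gt0.
pose above Q := \esum_(P in [set P | sub Q P]) lam P.
have above0 Q : 0 <= above Q by exact: esum_ge0.
have est Q : fam Q -> (t `^ p * side Q `^ b)%:E <=
    \esum_(P in [set P | sub P Q]) (lam P * (side P `^ d)%:E * sup_inv u P) +
    (side Q `^ d)%:E * sup_inv u Q * above Q.
  move=> /famP[pQ ltf]; apply: (@dyadic_cube_estimate R n kappa p d alpha b t L) => //.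
  - exact: mf.
  - by move=> x Qx; apply: lt_le_trans (posv Q pQ) (vu Q x Qx).
pose B : set T := [set Q | fam Q /\
  (tau * side Q `^ b)%:E <= (side Q `^ d)%:E * sup_inv u Q * above Q].
have [S [SB packS fullS]] := exists_packing (R := R) n0 B d0.
pose m Q := lam Q * (side Q `^ d)%:E +
  (if Q \in S then (side Q `^ d)%:E * above Q else 0).
have m1 Q : 0 <= lam Q * (side Q `^ d)%:E by rewrite mule_ge0.
have m2 Q : 0 <= (if Q \in S then (side Q `^ d)%:E * above Q else 0).
  by case: ifP => // _; rewrite mule_ge0.
have m0 Q : 0 <= m Q by rewrite adde_ge0.
(* After exchanging the sums, [lam P] is multiplied by the sum of l(Q)^d over the selected cubes
   inside [P], at most 2 l(P)^d by packing. *)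
have mL : \esum_(Q in [set: T]) m Q <= (3 * L)%:E.
  rewrite esumD//.
  have -> : (3 * L = L + 2 * L)%R by ring.
  rewrite EFinD; apply: leeD => //.
  rewrite -[leLHS](esum_mkcond S (fun Q => (side Q `^ d)%:E * above Q)).
  have -> : \esum_(Q in S) ((side Q `^ d)%:E * above Q) =
      \esum_(P in [set: T]) (lam P *
        \esum_(Q in S `&` [set Q | sub Q P]) (side Q `^ d)%:E).
    transitivity (\esum_(Q in S) \esum_(P in [set: T])
        if P \in [set P | sub Q P] then (side Q `^ d)%:E * lam P else 0).
      by apply: eq_esum => Q _; rewrite -esumZl// [LHS]esum_mkcond.
    rewrite exchange_esum; last by move=> Q P _ _; case: ifP => // _; rewrite mule_ge0.
    apply: eq_esum => P _; rewrite -esumZl// [RHS]esum_mkcondr.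
    apply: eq_esum => Q _; rewrite (_ : (P \in _) = (Q \in [set Q | sub Q P])) ?inE//.
    by rewrite muleC.
  apply: (@le_trans _ _ (\esum_(P in [set: T]) (2%:E * (lam P * (side P `^ d)%:E)))).
    apply: le_esum => P _; rewrite muleCA -EFinM.
    by apply: lee_wpmul2l => //; exact: packS.
  by rewrite esumZl// EFinM; apply: lee_wpmul2l.
have mfin : \esum_(Q in [set: T]) m Q < +oo by apply: le_lt_trans mL _; rewrite ltry.
pose good : set T := [set G | pos G /\
  (tau * side G `^ b)%:E <= \esum_(Q in [set Q | sub Q G]) (m Q * sup_inv u Q)].
have ve Q : v Q * sup_inv u Q <= 1.
  by apply: mul_sup_inv_le1 => // x; exact: vu.
have famS Q : S Q -> (tau * side Q `^ b)%:E <= m Q * sup_inv u Q.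
  move=> SQ; apply: (le_trans (SB Q SQ).2); rewrite /m mem_set// muleAC.
  by apply: lee_wpmul2r => //; rewrite leeDr.
have famgood Q : fam Q -> exists2 G, good G & sub Q G.
  move=> fQ; have [pQ _] := famP Q fQ.
  have me0 P : 0 <= m P * sup_inv u P by rewrite mule_ge0.
  have [BQ|nBQ] := pselect (B Q); last first.
    exists Q => //; split => //.
    apply: (@le_trans _ _ (\esum_(P in [set P | sub P Q])
      (lam P * (side P `^ d)%:E * sup_inv u P))); last first.
      by apply: le_esum => P _; apply: lee_wpmul2r => //; rewrite leeDl.
    rewrite leNgt; apply/negP => lt1.
    have lt2 : (side Q `^ d)%:E * sup_inv u Q * above Q < (tau * side Q `^ b)%:E.
      by rewrite ltNge; apply/negP => le2; apply: nBQ.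
    have := est Q fQ; apply/negP; rewrite -ltNge.
    apply: lt_le_trans (lteD lt1 lt2) _.
    by rewrite -EFinD lee_fin tauE; lra.
  have [SQ|nSQ] := pselect (S Q).
    exists Q => //; split => //; apply: (le_trans (famS Q SQ)).
    by apply: (le_esum_term (a := fun P => m P * sup_inv u P)).
  (* A cube of [B] that was not selected lies in a saturated cube [G]. Each selected [P] inside [G]
     supplies tau l(P)^b >= tau l(G)^(b-d) l(P)^d, because b - d = - p alpha <= 0, and the l(P)^d
     add up to at least l(G)^d. *)
  have [G QG fullG] := fullS Q BQ nSQ; exists G => //; split; first exact: posS pQ.
  apply: (@le_trans _ _ (\esum_(P in S `&` [set P | sub P G]) (m P * sup_inv u P)));
    last by apply: subset_le_esum => // P [].
  apply: (@le_trans _ _ (\esum_(P in S `&` [set P | sub P G])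
      ((tau * side G `^ (b - d))%:E * (side P `^ d)%:E))).
    rewrite esumZl//; last by rewrite lee_fin mulr_ge0 ?powR_ge0// ltW.
    apply: le_trans (lee_wpmul2l _ fullG); last first.
      by rewrite lee_fin mulr_ge0 ?powR_ge0// ltW.
    by rewrite -EFinM lee_fin -mulrA -powRD ?subrK// gt_eqF ?implybT.
  apply: le_esum => P [SP PG]; apply: le_trans (famS P SP).
  rewrite -EFinM lee_fin -mulrA ler_wpM2l ?(ltW tau0)//.
  rewrite -[in leRHS](subrK d b) [leRHS]powRD; last by rewrite (gt_eqF (l0 P)) implybT.
  rewrite ler_wpM2r ?powR_ge0//.
  have -> : (b - d = - (p * alpha))%R by rewrite bE dE; ring.
  rewrite !powRN lef_pV2 ?posrE ?powR_gt0//.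
  by apply: le_dyadic_side_powR => //; rewrite mulr_ge0// ltW.
apply: (@le_trans _ _ (cover_cost cube c (\bigcup_(G in good `|` null) cube G))).
  apply: le_cover_cost => x [Q [/famgood[G gG QG]|nQ] Qx]; last by exists Q => //; right.
  by exists G; [left|exact: QG].
apply: le_trans (dyadic_cube_cover_content n0 r1 tau0 b0 c0 m0 e0 v0 mfin
    _ ve cle nullP _) _.
- by move=> P Q; exact: le_sup_inv.
- move=> G [pG tG]; split => //; rewrite ltNge leye_eq; apply/negP => /eqP eG.
  by have := ve G; rewrite eG gt0_muley ?posv// leye_eq.
apply: lee_poweR2r; first exact: ltW.
  by rewrite mule_ge0 ?esum_ge0// lee_fin invr_ge0 ltW.
rewrite lee_pdivrMl// -EFinM (le_trans mL)// lee_fin le_eqVlt; apply/orP; left.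
by apply/eqP; rewrite tauE; field; rewrite gt_eqF.
Qed.

End weak_type.

(** * Averages over cubes and level sets of the maximal operator *)

Section cube_averages.
Context {R : realType} {n : nat}.
Local Notation cube := (@dyadic_cube R n).
Local Notation side := (@dyadic_side R n).
Local Notation mu := (@lebesgue_rV R n).

Lemma cube_avg_ge0 (w : Rn R n -> R) Q : (forall x, 0 <= w x)%R -> 0 <= cube_avg w Q.
Proof.
move=> w0; rewrite mule_ge0 ?inve_ge0//.
by apply: integral_ge0 => x _; rewrite lee_fin.
Qed.

Lemma cube_avg_gt0_sub (w : Rn R n -> R) P Q :
  (forall x, 0 <= w x)%R -> measurable_fun [set: Rn R n] w ->
  0 < mu (cube Q) -> cube P `<=` cube Q ->
  0 < cube_avg w P -> 0 < cube_avg w Q.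
Proof.
move=> w0 mw muQ PQ; rewrite /cube_avg => wP.
have int0 (D : set (Rn R n)) : 0 <= \int[mu]_(y in D) (w y)%:E.
  by apply: integral_ge0 => x _; rewrite lee_fin.
have wP0 : 0 < \int[mu]_(y in cube P) (w y)%:E.
  by rewrite lt_def int0 andbT; apply/eqP => E; rewrite E mule0 ltxx in wP.
apply: mule_gt0.
  rewrite inve_gt0//; first by rewrite gt_eqF.
  by rewrite lt_eqF// lebesgue_dyadic_cube_lty.
apply: lt_le_trans wP0 _; apply: ge0_subset_integral => //.
- exact: measurable_dyadic_cube.
- exact: measurable_dyadic_cube.
- by apply/measurable_EFinP; exact: measurable_funTS.
- by move=> x _; rewrite lee_fin.
Qed.

(** A cube missing [x] contributes 0, which does not exceed the positive [t]. *)
Lemma fractional_maximal_gtP (beta t : R) (f : Rn R n -> R) x :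
  (0 < t)%R -> t%:E < fractional_maximal beta f x ->
  exists2 Q, cube Q x &
    t%:E < cube_avg (fun y => `|f y|%R) Q * (side Q `^ beta)%:E.
Proof.
move=> t0 /ereal_sup_gt[_ [Q _ <-]]; rewrite indicE.
case: (boolP (x \in cube Q)) => [/set_mem Qx|_].
  by rewrite mul1e => tQ; exists Q.
by rewrite mul0e mul0e => /lt_trans/(_ (_ : 0 < t%:E)); rewrite lte_fin ltxx => /(_ t0).
Qed.

Lemma fractional_maximal_ge (beta : R) (w : Rn R n -> R) Q x :
  (forall y, 0 <= w y)%R -> cube Q x ->
  cube_avg w Q * (side Q `^ beta)%:E <= fractional_maximal beta w x.
Proof.
move=> w0 Qx; apply: ereal_sup_ubound; exists Q => //.
rewrite indicE mem_set// mul1e; congr (cube_avg _ _ * _).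
by apply/funext => y; rewrite ger0_norm.
Qed.

End cube_averages.

Theorem theorem1p3 (R : realType) (n : nat) (d alpha gamma p q delta : R)
    (hn : (2 <= n)%N) (hd : (0 < d <= n%:R)%R)
    (halpha : (0 <= alpha < n%:R)%R) (hgamma : (0 <= gamma <= alpha)%R)
    (hp : p = (d / n%:R)%R)
    (hq : (d / n%:R <= q)%R)
    (hq_alpha : (0 < alpha)%R -> (q <= n%:R / alpha)%R)
    (hdelta : delta = (q * (n%:R - alpha + gamma))%R) :
  exists C : R, (0 < C)%R /\
    forall w f : Rn R n -> R, weight w -> locally_integrable_rV f ->
      ereal_sup [set t%:E *
          (weighted_content delta w
            [set x | t%:E < fractional_maximal alpha f x]) `^ (q^-1)
        | t in [set t : R | (0 < t)%R]]
      <= C%:E * (choquet_integral d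
            (fun x => (`|f x| `^ p)%:E *
              (fractional_maximal (gamma * q) w x) `^ (p / q))) `^ (p^-1).
Proof.
have n0 : (0 < n)%N by exact: ltnW.
have nR0 : (0 < n%:R :> R)%R by rewrite ltr0n.
case/andP: hd => d0 dn.
have p0 : (0 < p)%R by rewrite hp divr_gt0.
have p1 : (p <= 1)%R by rewrite hp ler_pdivrMr// mul1r.
have dE : d = (n%:R * p)%R by rewrite hp mulrC divfK// gt_eqF.
have pq : (p <= q)%R by rewrite hp.
have q0 : (0 < q)%R by exact: lt_le_trans pq.
pose r := (q / p)%R; have r1 : (1 <= r)%R by rewrite ler_pdivlMr// mul1r.
pose b := (p * (n%:R - alpha))%R.
pose cube := @dyadic_cube R n; pose side := @dyadic_side R n.
pose mu := @lebesgue_rV R n.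
have l0 Q : (0 < side Q)%R by exact: dyadic_side_gt0.
have avg_ge0 (w : Rn R n -> R) Q : (forall x, 0 <= w x)%R ->
    0 <= cube_avg w Q * (side Q `^ delta)%:E.
  by move=> w0; rewrite mule_ge0 ?cube_avg_ge0// lee_fin powR_ge0.
(* In fact kappa = 1; only the homogeneity of the volume of cubes matters, and
   everything vanishes if kappa = 0. *)
pose kappa := fine (mu (cube (0, 0)%R)).
have muE P : mu (cube P) = (kappa * side P ^+ n)%:E.
  rewrite /mu lebesgue_dyadic_cube EFinM muleC fineK//.
  by rewrite ge0_fin_numE ?measure_ge0// lebesgue_dyadic_cube_lty.
have [k0|k0] := eqVneq kappa 0%R.
  exists 1%R; split=> // w f [w0 _] [mf _]; apply: ge_ereal_sup => _ [t t0 <-].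
  rewrite [X in weighted_content _ _ X](_ : _ = set0).
    rewrite [weighted_content _ _ _]cover_cost_set0; last 2 first.
    - by move=> Q; exact: avg_ge0.
    - exact: (0, 0)%R.
    by rewrite poweR0r ?invr_eq0 ?gt_eqF// mule0 mul1e poweR_ge0.
  rewrite -subset0 => x /= /(fractional_maximal_gtP t0)[Q _].
  rewrite /cube_avg null_set_integral ?mule0 ?mul0e ?lte_fin ?ltNge ?(ltW t0)//.
  - exact: measurable_dyadic_cube.
  - apply/measurable_EFinP/measurable_funTS.
    by apply: (measurableT_comp (@normr_measurable R setT)).
  - by have := muE Q; rewrite k0 mul0r.
have {}k0 : (0 < kappa)%R by rewrite lt_def k0 fine_ge0.
have muQ P : 0 < mu (cube P) by rewrite muE lte_fin mulr_gt0// exprn_gt0.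
(* 24 is 4 times 6: the 4 comes from the discretization, the 6 from the total mass 3 L divided by
   tau = t^p / 2. *)
exists (24 `^ p^-1)%R; split; first exact: powR_gt0.
move=> w f [w0 [mw _]] [mf _].
set F : Rn R n -> \bar R := fun x => _.
have [->|Iy] := eqVneq (choquet_integral d F) +oo.
  by rewrite poweRyr ?invr_eq0 ?gt_eqF// gt0_muley ?leey// lte_fin powR_gt0.
have F0 x : 0 <= F x by rewrite mule_ge0 ?lee_fin ?powR_ge0 ?poweR_ge0.
have I0 : 0 <= choquet_integral d F.
  apply: integral_ge0 => s _; apply: cover_cost_ge0 => Q.
  by rewrite mule_ge0 ?cube_avg_ge0// lee_fin powR_ge0.
have Ify : choquet_integral d F < +oo by rewrite lt_neqAle Iy leey.
pose i := fine (choquet_integral d F).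
have IE : choquet_integral d F = i%:E by rewrite fineK// ge0_fin_numE.
have i0 : (0 <= i)%R by rewrite -lee_fin -IE.
apply: ge_ereal_sup => _ [t t0 <-].
set H := weighted_content _ _ _.
have HE : H = cover_cost cube (fun Q => cube_avg w Q * (side Q `^ delta)%:E)
  [set x | t%:E < fractional_maximal alpha f x] by [].
have tp0 : (0 < t `^ p)%R by exact: powR_gt0.
have bound eps : (0 < eps)%R -> H <= (6 * (4 * i + eps) / t `^ p)%:E `^ r.
  move=> eps0.
  have [lam [lam0 lamI Flam]] := atomic_decomposition muQ eps0 F0 Ify.
  have L0 : (0 < 4 * i + eps)%R by rewrite ltr_wpDl ?mulr_ge0.
  (* A cube where |f| has a large average goes to [fam] if [w] has positive average on it, and
     otherwise to [null], where it costs nothing. *)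
  pose pos := [set Q | 0 < cube_avg w Q].
  pose null := [set Q | cube_avg w Q = 0].
  pose fam := [set Q | pos Q /\
    t%:E < cube_avg (fun y => `|f y|%R) Q * (side Q `^ alpha)%:E].
  apply: (@le_trans _ _ (cover_cost cube (fun Q => cube_avg w Q * (side Q `^ delta)%:E)
      (\bigcup_(Q in fam `|` null) cube Q))).
    rewrite HE; apply: le_cover_cost => x /(fractional_maximal_gtP t0)[Q Qx tQ].
    exists Q => //; have [nQ|nQ] := eqVneq (cube_avg w Q) 0; first by right.
    by left; split=> //; rewrite /pos /= lt_def nQ cube_avg_ge0.
  apply: (@weak_type_content R n kappa p d alpha b t r (4 * i + eps)%R lam _
    (fun Q => (cube_avg w Q * (side Q `^ (gamma * q))%:E) `^ (p / q))
    (fun x => fractional_maximal (gamma * q) w x `^ (p / q)) f pos).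
  - exact: k0.
  - exact: muE.
  - by rewrite p0.
  - exact: dE.
  - by [].
  - exact: halpha.
  - exact: t0.
  - exact: r1.
  - exact: n0.
  - exact: L0.
  - exact: lam0.
  - exact: mf.
  - by rewrite EFinD EFinM -IE.
  - by move=> x; exact: poweR_ge0.
  - exact: Flam.
  - by move=> Q; exact: avg_ge0.
  - by move=> Q; exact: poweR_ge0.
  - move=> Q x Qx; apply: lee_poweR2r.
    + by rewrite divr_ge0// ltW.
    + by rewrite mule_ge0 ?cube_avg_ge0// lee_fin powR_ge0.
    + exact: fractional_maximal_ge.
  (* Both sides agree: the powers p/q and q/p cancel on the average of [w], and the side gets the
     exponent gamma q + b q / p = delta. *)
  - move=> Q; have := cube_avg_ge0 Q w0; move: (cube_avg w Q) => av av0.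
    have avl0 : 0 <= av * (side Q `^ (gamma * q))%:E.
      by rewrite mule_ge0// lee_fin powR_ge0.
    rewrite [leRHS]poweRM ?poweR_ge0 ?lee_fin ?powR_ge0//.
    have -> : (av * (side Q `^ (gamma * q))%:E) `^ (p / q) `^ r =
        av * (side Q `^ (gamma * q))%:E.
      by rewrite -poweRrM /r mulrA divfK ?gt_eqF// divff ?gt_eqF// poweRe1.
    rewrite poweR_EFin -powRrM -muleA -EFinM -powRD ?(gt_eqF (l0 Q)) ?implybT//.
    rewrite (_ : gamma * q + b * (q / p) = delta)%R// hdelta /b; field.
    by rewrite gt_eqF.
  - by move=> Q nQ; rewrite nQ mul0e.
  - by move=> P Q PQ; exact: (cube_avg_gt0_sub w0 mw).
  - by move=> Q posQ; apply: poweR_gt0; rewrite mule_gt0// lte_fin powR_gt0.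
  - move=> Q [posQ tQ]; split=> //; move: tQ.
    rewrite -lte_pdivrMr ?powR_gt0// /cube_avg.
    rewrite [(lebesgue_rV _)^-1](_ : _ = (kappa * side Q ^+ n)^-1%:E); last first.
      by rewrite [lebesgue_rV _]muE inver gt_eqF// mulr_gt0// exprn_gt0.
    rewrite lte_pdivlMl ?mulr_gt0 ?exprn_gt0// -!EFinM.
    have -> : (kappa * side Q ^+ n * (t / side Q `^ alpha) =
        t * (kappa * side Q `^ (n%:R - alpha)))%R; last exact: id.
    rewrite powRB ?(gt_eqF (l0 Q)) ?implybT// powR_mulrn ?ltW//.
    by field; rewrite gt_eqF// powR_gt0.
have H0 : 0 <= H by apply: cover_cost_ge0 => Q; exact: avg_ge0.
have Hfin : H \is a fin_num.
  by rewrite ge0_fin_numE//; apply: le_lt_trans (bound 1%R ltr01) _; rewrite ltry.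
have h0 : (0 <= fine H)%R by exact: fine_ge0.
rewrite IE -(fineK Hfin) !poweR_EFin -!EFinM lee_fin -powRM//.
have y0 : (0 <= t * fine H `^ q^-1)%R by rewrite mulr_ge0 ?powR_ge0// ltW.
(* After raising to the power [p] the bound is affine in the error, which can then tend to 0; the
   choice eps / 6 turns 6 (4 i + eps / 6) into 24 i + eps. *)
suff : ((t * fine H `^ q^-1) `^ p <= 24 * i)%R.
  move=> /(ge0_ler_powR (_ : 0 <= p^-1)%R); rewrite invr_ge0 ltW// => /(_ isT).
  rewrite !nnegrE powR_ge0 mulr_ge0// => /(_ isT isT).
  by rewrite -powRrM mulfV ?gt_eqF// powRr1.
apply/ler_addgt0Pr => eps eps0.
have := bound (eps / 6)%R (divr_gt0 eps0 (ltr0Sn R 5)).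
rewrite -(fineK Hfin) poweR_EFin lee_fin => Hle.
rewrite powRM ?powR_ge0 ?(ltW t0)// -powRrM mulrC -ler_pdivlMr//.
have -> : (24 * i + eps = 6 * (4 * i + eps / 6))%R by field.
set x := (6 * _ / _)%R in Hle *.
have x0 : (0 <= x)%R by apply: divr_ge0; [lra|exact: ltW].
have -> : x = ((x `^ r) `^ (q^-1 * p))%R.
  rewrite -powRrM /r (_ : q / p * (q^-1 * p) = 1)%R ?powRr1//.
  by field; rewrite !gt_eqF.
apply: ge0_ler_powR => //; rewrite ?nnegrE ?powR_ge0//.
by rewrite mulr_ge0 ?invr_ge0// ltW.
Qed.
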